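(* Let $\mathcal{Q}_h$ be a convex quadrilateral triangulation of $\Omega$ from a regular family. Then $$\mathbf{curl}_h M_{h0}=\{\mathbf{w}_h\in\mathbf{V}_{h0}:\mathrm{div}_h\mathbf{w}_h=0\}.$$
   Context: Setting: $\Omega\subset\mathbb{R}^2$ is a bounded, simply connected Lipschitz domain covered by a (conforming) triangulation $\mathcal{Q}_h$ into convex quadrilaterals; Euler's formula (number of cells) + (number of vertices) = (number of edges) + 1 holds. $\mathcal{N}_h$ and $\mathcal{N}_h^b$ are the sets of all vertices and of boundary vertices; $\mathcal{E}_h^i$ and $\mathcal{E}_h^b$ are the sets of interior and boundary edges. For each edge $e$, $\mathbf{n}_e$ is a fixed unit normal. $\mathbf{curl}$ of a scalar function is its gradient rotated by a right angle, $\mathbf{curl}\,\varphi=(\partial_y\varphi,-\partial_x\varphi)^\top$; $\mathbf{curl}_h$ and $\mathrm{div}_h$ are the cell-by-cell operators. Geometry: a convex quadrilateral $Q$ has consecutive vertices $a_1,\dots,a_4$, edges $e_1=a_1a_2$, $e_2=a_2a_3$, $e_3=a_3a_4$, $e_4=a_4a_1$, and $m_i$ is the midpoint of $e_i$. The segments $m_1m_3$ and $m_2m_4$ meet at their common midpoint $O$. Put $\mathbf{r}=\overrightarrow{Om_3}$, $\mathbf{s}=\overrightarrow{Om_4}$ (labelled so that $\mathbf{r}\times\mathbf{s}>0$) and, with $O$ as origin, $\xi(a\mathbf{r}+b\mathbf{s})=b$, $\eta(a\mathbf{r}+b\mathbf{s})=a$. A family of triangulations is regular if $\mathcal{R}_Q=\max\{\frac{|\mathbf{r}||\mathbf{s}|}{\mathbf{r}\times\mathbf{s}},\frac{|\mathbf{r}|}{|\mathbf{s}|},\frac{|\mathbf{s}|}{|\mathbf{r}|}\}$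 is uniformly bounded over all cells of all triangulations. Spaces: $P_Q=P_1(Q)+\mathrm{span}\{\xi^2,\eta^2\}$ and $P_Q^M=P_2(Q)+\mathrm{span}\{\xi^3,\eta^3\}$. $V_{h0}$ is the space of $w\in L^2(\Omega)$ with $w|_Q\in P_Q$ for every cell $Q$ such that $\frac1{|e|}\int_ew\,ds$ is continuous across (takes the same value from both sides of) every $e\in\mathcal{E}_h^i$ and vanishes for every $e\in\mathcal{E}_h^b$; $\mathbf{V}_{h0}=(V_{h0})^2$. $M_{h0}$ (quadrilateral Morley space of Park–Sheen) is the space of $w_h\in L^2(\Omega)$ with $w_h|_Q\in P_Q^M$ for every cell $Q$, such that $w_h$ is continuous at every vertex $a\in\mathcal{N}_h$, $\frac1{|e|}\int_e\partial_{\mathbf{n}_e}w_h\,ds$ is continuous across every $e\in\mathcal{E}_h^i$, $w_h(a)=0$ for $a\in\mathcal{N}_h^b$, and $\frac1{|e|}\int_e\partial_{\mathbf{n}_e}w_h\,ds=0$ for $e\in\mathcal{E}_h^b$. On $P_Q^M$ the eight functionals $v\mapsto v(a_i)$, $v\mapsto\frac1{|e_i|}\int_{e_i}\partial_{\mathbf{n}_{e_i}}v\,ds$ ($i=1,\dots,4$) are unisolvent. *)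

(* Defs.v *)
(* The plane R^2 is R * R, for an arbitrary R : realType. *)
From mathcomp Require Import all_boot all_order all_algebra finmap.
From mathcomp Require Import all_classical all_reals all_analysis.
From mathcomp Require Import ring.

Set Implicit Arguments.
Unset Strict Implicit.
Unset Printing Implicit Defensive.

Import Order.TTheory GRing.Theory Num.Theory.
Import numFieldNormedType.Exports.

Local Open Scope classical_set_scope.
Local Open Scope ring_scope.

Notation plane R := (R * R)%type.

Section Plane.
Variable R : realType.
Implicit Types (u v x : plane R) (f : plane R -> R).

Definition dot u v : R := u.1 * v.1 + u.2 * v.2.
Definition cross u v : R := u.1 * v.2 - u.2 * v.1.
(* Euclidean length; the library norm on R * R is the sup norm. *)
Definition enorm u : R := Num.sqrt (dot u u).
Definition rot90 u : plane R := (- u.2, u.1).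
Definition midpoint u v : plane R := 2^-1 *: (u + v).
Definition segment u v : set (plane R) :=
  [set u + t *: (v - u) | t in `[0%R, 1%R]].

Definition dx f x : R := 'D_((1, 0) : plane R) f x.
Definition dy f x : R := 'D_((0, 1) : plane R) f x.

Definition curl f x : plane R := (dy f x, - dx f x).
Definition div (F : plane R -> plane R) x : R :=
  dx (fun y => (F y).1) x + dy (fun y => (F y).2) x.

(* Integral over the segment [u, v] with respect to arc length. *)
Definition line_integral u v f : R :=
  enorm (v - u) * \int[lebesgue_measure]_(t in `[0%R, 1%R]) f (u + t *: (v - u)).
Definition line_average u v f : R :=
  (enorm (v - u))^-1 * line_integral u v f.

(* Polynomials of total degree at most k. *)
Definition poly_deg k : set (plane R -> R) :=
  [set f | exists c : nat -> nat -> R, f =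
    fun x => \sum_(i < k.+1) \sum_(j < k.+1 - i) c i j * x.1 ^+ i * x.2 ^+ j].

End Plane.

Section Domain.
Variable R : realType.
Implicit Type Om : set (plane R).

Definition boundary Om : set (plane R) := closure Om `\` interior Om.

Definition simply_connected Om : Prop :=
  connected Om /\
  forall g : R -> plane R,
    {within `[0%R, 1%R], continuous g} ->
    (forall t, t \in `[0%R, 1%R] -> Om (g t)) -> g 0 = g 1 ->
  exists H : plane R -> plane R,
    [/\ {within `[0%R, 1%R] `*` `[0%R, 1%R], continuous H},
        forall s t, s \in `[0%R, 1%R] -> t \in `[0%R, 1%R] -> Om (H (s, t)),
        forall t, t \in `[0%R, 1%R] -> H (0, t) = g t /\ H (1, t) = g 0 &
        forall s, s \in `[0%R, 1%R] -> H (s, 0) = g 0 /\ H (s, 1) = g 0].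

(* Near each boundary point p, in suitable orthonormal coordinates centred at
   p, the set is the strict epigraph of a Lipschitz function. *)
Definition lipschitz_boundary Om : Prop :=
  forall p, boundary Om p ->
  exists (u : plane R) (d L : R) (g : R -> R),
    [/\ enorm u = 1, 0 < d,
        forall s t, `|g s - g t| <= L * `|s - t| &
        forall s t, `|s| < d -> `|t| < d ->
          Om (p + s *: u + t *: rot90 u) <-> g s < t].

Definition lipschitz_domain Om : Prop :=
  [/\ Om !=set0, open Om, connected Om, bounded_set Om & lipschitz_boundary Om].

End Domain.

Section Quadrilateral.
Variable R : realType.
(* The vertices a_1, ..., a_4 are indexed by 0, ..., 3; [ordS] is the cyclic
   successor, so that e_i is the segment [a i, a (ordS i)]. *)
Implicit Type a : 'I_4 -> plane R.

(* Strict convexity, with the vertices listed counterclockwise. *)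
Definition convex_quad a : Prop :=
  forall i, 0 < cross (a (ordS i) - a i) (a (ordS (ordS i)) - a (ordS i)).

Definition quad_region a : set (plane R) :=
  [set x | exists t : 'I_4 -> R,
    [/\ forall i, 0 <= t i, \sum_i t i = 1 & x = \sum_i t i *: a i]].

Definition quad_edge a i : set (plane R) := segment (a i) (a (ordS i)).

(* [quad_mid a i] is m_(i+1), the midpoint of e_(i+1). *)
Definition quad_mid a (i : 'I_4) : plane R := midpoint (a i) (a (ordS i)).
Definition quad_center a : plane R :=
  midpoint (quad_mid a (inord 0)) (quad_mid a (inord 2)).
(* For counterclockwise vertices, r x s > 0. *)
Definition quad_r a : plane R := quad_mid a (inord 2) - quad_center a.
Definition quad_s a : plane R := quad_mid a (inord 3) - quad_center a.

(* The coordinates determined by x = O + eta *: r + xi *: s; see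
   [quad_xiE] and [quad_etaE]. *)
Definition quad_xi a (x : plane R) : R :=
  cross (quad_r a) (x - quad_center a) / cross (quad_r a) (quad_s a).
Definition quad_eta a (x : plane R) : R :=
  cross (x - quad_center a) (quad_s a) / cross (quad_r a) (quad_s a).

Definition shape_ratio a : R :=
  let r := quad_r a in let s := quad_s a in
  Num.max (enorm r * enorm s / cross r s)
          (Num.max (enorm r / enorm s) (enorm s / enorm r)).

Definition P_quad a : set (plane R -> R) :=
  [set f | exists2 p, poly_deg 1 p & exists b c : R,
     f = fun x => p x + b * quad_xi a x ^+ 2 + c * quad_eta a x ^+ 2].

Definition PM_quad a : set (plane R -> R) :=
  [set f | exists2 p, poly_deg 2 p & exists b c : R,
     f = fun x => p x + b * quad_xi a x ^+ 3 + c * quad_eta a x ^+ 3].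

Lemma ordS_inord4 i : (i < 4)%N -> ordS (inord i : 'I_4) = inord (i.+1 %% 4).
Proof. by move=> i4; apply: val_inj; rewrite /= !inordK ?ltn_pmod. Qed.

Lemma quad_centerE a :
  quad_center a = midpoint (quad_mid a (inord 1)) (quad_mid a (inord 3)).
Proof.
rewrite /quad_center /quad_mid /midpoint !ordS_inord4 //=.
case: (a (inord 0)) (a (inord 1)) (a (inord 2)) (a (inord 3)) =>
  [x0 y0] [x1 y1] [x2 y2] [x3 y3].
by congr pair; rewrite /= !/(_ *: _) /=; ring.
Qed.

Lemma cross_rs_gt0 a : convex_quad a -> 0 < cross (quad_r a) (quad_s a).
Proof.
move=> aP; move: (aP (inord 0)) (aP (inord 2)).
rewrite /quad_r /quad_s /quad_center /quad_mid /midpoint !ordS_inord4 //=.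
rewrite modnn !modn_small //.
case: (a (inord 0)) (a (inord 1)) (a (inord 2)) (a (inord 3)) =>
  [x0 y0] [x1 y1] [x2 y2] [x3 y3].
rewrite /cross /= => h1 h2.
set c := (X in 0 < X).
suff -> : c = 8^-1 * (((x1 - x0) * (y2 - y1) - (y1 - y0) * (x2 - x1))
  + ((x3 - x2) * (y0 - y3) - (y3 - y2) * (x0 - x3))).
  by rewrite mulr_gt0 // (addr_gt0 h1 h2).
by rewrite /c !/(_ *: _) /=; field.
Qed.

Lemma quad_xiE a (b c : R) : convex_quad a ->
  quad_xi a (quad_center a + b *: quad_r a + c *: quad_s a) = c.
Proof.
move=> /cross_rs_gt0 /lt0r_neq0; rewrite /quad_xi.
case: (quad_center a) (quad_r a) (quad_s a) => [z1 z2] [r1 r2] [s1 s2].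
by rewrite /cross /= !/(_ *: _) /= => h; field.
Qed.

Lemma quad_etaE a (b c : R) : convex_quad a ->
  quad_eta a (quad_center a + b *: quad_r a + c *: quad_s a) = b.
Proof.
move=> /cross_rs_gt0 /lt0r_neq0; rewrite /quad_eta.
case: (quad_center a) (quad_r a) (quad_s a) => [z1 z2] [r1 r2] [s1 s2].
by rewrite /cross /= !/(_ *: _) /= => h; field.
Qed.

End Quadrilateral.

Record mesh (R : realType) := Mesh {
  ncell : nat;
  cell : 'I_ncell -> 'I_4 -> plane R }.
Arguments cell {R} m _ _.

Section Mesh.
Variables (R : realType) (Om : set (plane R)) (T : mesh R).
Implicit Types (k l : 'I_(ncell T)) (i j : 'I_4).

Definition mesh_vertices : {fset plane R} :=
  [fset cell T k i | k in 'I_(ncell T), i in 'I_4]%fset.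
(* An edge is a closed segment, as a set of points. *)
Definition mesh_edges : {fset set (plane R)} :=
  [fset quad_edge (cell T k) i | k in 'I_(ncell T), i in 'I_4]%fset.

Definition boundary_vertex (x : plane R) : Prop :=
  x \in mesh_vertices /\ boundary Om x.
Definition boundary_edge (e : set (plane R)) : Prop :=
  e \in mesh_edges /\ e `<=` boundary Om.
Definition interior_edge (e : set (plane R)) : Prop :=
  e \in mesh_edges /\ ~ e `<=` boundary Om.

(* Conforming triangulation of Om into convex quadrilaterals. *)
Definition triangulation : Prop :=
  [/\ forall k, convex_quad (cell T k),
      closure Om = \bigcup_(k in [set: 'I_(ncell T)]) quad_region (cell T k) &
      forall k l, k != l ->
        let I := quad_region (cell T k) `&` quad_region (cell T l) in
        [\/ I = set0,
            exists i j, cell T k i = cell T l j /\ I = [set cell T k i] |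
            exists i j, quad_edge (cell T k) i = quad_edge (cell T l) j /\
                        I = quad_edge (cell T k) i]].

Definition euler_formula : Prop :=
  (ncell T + #|` mesh_vertices| = #|` mesh_edges| + 1)%N.

Definition unit_normals (n : set (plane R) -> plane R) : Prop :=
  forall k i, let e := quad_edge (cell T k) i in
    enorm (n e) = 1 /\ dot (n e) (cell T k (ordS i) - cell T k i) = 0.

(* A piecewise polynomial function on Om is represented by the family of its
   polynomial pieces, each taken as a function on the whole plane: the cells
   cover Om up to a null set and a polynomial is determined by its restriction
   to a cell, so this is the same as a class in L^2(Om).  The value or trace of
   w from the side of the k-th cell is given by [w k]. *)
Definition broken := 'I_(ncell T) -> plane R -> R.
Definition broken_vec := 'I_(ncell T) -> plane R -> plane R.

Definition edge_average k i (f : plane R -> R) : R :=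
  line_average (cell T k i) (cell T k (ordS i)) f.

Definition Vh0 : set broken :=
  [set w | [/\ forall k, P_quad (cell T k) (w k),
    forall e, interior_edge e -> forall k l i j,
      quad_edge (cell T k) i = e -> quad_edge (cell T l) j = e ->
      edge_average k i (w k) = edge_average l j (w l) &
    forall e, boundary_edge e -> forall k i,
      quad_edge (cell T k) i = e -> edge_average k i (w k) = 0]].

Definition Vh0_vec : set broken_vec :=
  [set w | Vh0 (fun k x => (w k x).1) /\ Vh0 (fun k x => (w k x).2)].

(* The quadrilateral Morley space; n is the choice of edge normals. *)
Definition Mh0 (n : set (plane R) -> plane R) : set broken :=
  [set w | [/\ forall k, PM_quad (cell T k) (w k),
    forall x, x \in mesh_vertices -> forall k l i j,
      cell T k i = x -> cell T l j = x -> w k x = w l x,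
    forall e, interior_edge e -> forall k l i j,
      quad_edge (cell T k) i = e -> quad_edge (cell T l) j = e ->
      edge_average k i ('D_(n e) (w k)) = edge_average l j ('D_(n e) (w l)),
    forall x, boundary_vertex x -> forall k i,
      cell T k i = x -> w k x = 0 &
    forall e, boundary_edge e -> forall k i,
      quad_edge (cell T k) i = e -> edge_average k i ('D_(n e) (w k)) = 0]].

Definition curl_h (w : broken) : broken_vec := fun k => curl (w k).
Definition div_h (w : broken_vec) : broken := fun k => div (w k).

End Mesh.
Arguments Vh0 {R} Om T _.
Arguments Vh0_vec {R} Om T _.
Arguments Mh0 {R} Om T n _.

Definition regular_family (R : realType) (H : Type) (T : H -> mesh R) : Prop :=
  exists C : R, forall (h : H) (k : 'I_(ncell (T h))), shape_ratio (cell (T h) k) <= C.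

(* Main.v *)
Require Import Defs.
From mathcomp Require Import all_boot all_order all_algebra finmap.
From mathcomp Require Import all_classical all_reals all_analysis.
From mathcomp Require Import ring lra zify.

(** The inclusion of [curl_h Mh0] in the divergence-free fields is local.  Over an
    edge, the mean tangential derivative of a function is the difference of its
    end values divided by the length, so the vertex values and the mean normal
    derivative together determine the mean gradient, hence the mean curl
    ([line_average_grad], [curl_Mh0]).

    Conversely, a divergence-free field of [Vh0_vec] has on every cell a potential
    in the local Morley space, unique up to a constant ([potential]), and one has
    to choose the constants so that the potentials agree at the vertices and
    vanish at the boundary vertices.  The mean normal derivatives then come for
    free from the tangential averages of the field.  Since the normal averages of
    the field are continuous across edges and vanish on boundary edges, the
    increments of the local potentials along edges form a 1-cochain on the mesh,
    zero on the boundary, and of circulation zero around every cell.  So what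
    remains is that the first cohomology of the mesh relative to its boundary is
    zero ([cochain_potential]).

    This cohomology is computed by counting dimensions in the complex
    (interior vertices) -> (interior edges) -> (cells).
    - The first map is injective, and the transpose of the second has only the
      constants in its kernel.  Both facts follow as the cells are connected
      through interior edges ([edge_connected]), which holds as the domain is
      connected and as finitely many vertices cannot disconnect it.
    - There are at most as many boundary vertices as boundary edges, since every
      boundary vertex emits a boundary edge ([boundary_out_dart]).
    - Euler's formula turns this into: the number of interior edges is at most
      the number of interior vertices plus the number of cells minus 1, so the
      kernel of the second map is the image of the first ([cochain_exact]).

    The Lipschitz condition enters through one consequence: the domain is the
    interior of its closure ([boundary_not_interior_closure]).  It implies that an
    edge is a boundary edge exactly when it belongs to a single cell ([twinP]). *)

Set Implicit Arguments.
Unset Strict Implicit.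
Unset Printing Implicit Defensive.

Import Order.TTheory GRing.Theory Num.Theory.
Import numFieldNormedType.Exports.

Local Open Scope classical_set_scope.
Local Open Scope ring_scope.

(** * Calculus and averages over segments *)

Section Calculus.
Variable R : realType.
Implicit Types (f g : plane R -> R) (u v x : plane R).

(** Both partial derivatives at once.  Asking for every direction is what makes
    the derivative along an edge available. *)
Definition has_grad f g1 g2 : Prop :=
  forall x v, is_derive x v f (v.1 * g1 x + v.2 * g2 x).

Lemma has_grad_eq f g1 g2 h1 h2 : has_grad f g1 g2 ->
  (forall x, g1 x = h1 x) -> (forall x, g2 x = h2 x) -> has_grad f h1 h2.
Proof. by move=> fg e1 e2 x v; rewrite -e1 -e2; exact: fg. Qed.

Lemma has_grad_cst c : has_grad (fun=> c) (fun=> 0) (fun=> 0).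
Proof.
by move=> x v; rewrite !mulr0 addr0; exact: is_derive_cst.
Qed.

Lemma has_gradD f g f1 f2 g1 g2 : has_grad f f1 f2 -> has_grad g g1 g2 ->
  has_grad (fun x => f x + g x) (fun x => f1 x + g1 x) (fun x => f2 x + g2 x).
Proof.
move=> df dg x v.
by apply: is_derive_eq (is_deriveD (df x v) (dg x v)) _; ring.
Qed.

Lemma has_gradM f g f1 f2 g1 g2 : has_grad f f1 f2 -> has_grad g g1 g2 ->
  has_grad (fun x => f x * g x)
    (fun x => f x * g1 x + g x * f1 x) (fun x => f x * g2 x + g x * f2 x).
Proof.
move=> df dg x v.
by apply: is_derive_eq (is_deriveM (df x v) (dg x v)) _; rewrite /GRing.scale /=; ring.
Qed.

Lemma has_gradZ c f f1 f2 : has_grad f f1 f2 ->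
  has_grad (fun x => c * f x) (fun x => c * f1 x) (fun x => c * f2 x).
Proof.
move=> df; apply: has_grad_eq (has_gradM (has_grad_cst c) df) _ _ => x;
  by rewrite mulr0 addr0.
Qed.

Lemma has_gradX f f1 f2 n : has_grad f f1 f2 ->
  has_grad (fun x => f x ^+ n) (fun x => n%:R * f x ^+ n.-1 * f1 x)
                               (fun x => n%:R * f x ^+ n.-1 * f2 x).
Proof.
move=> df x v; rewrite -exprfctE.
by apply: is_derive_eq (is_deriveX n (df x v)) _; rewrite /GRing.scale /=; ring.
Qed.

Lemma has_grad_lin a b : has_grad (fun x => a * x.1 + b * x.2) (fun=> a) (fun=> b).
Proof.
move=> x v; have lim : (fun h : R => h^-1 *: (((fun x => a * x.1 + b * x.2) \o shift x) (h *: v) -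
     (a * x.1 + b * x.2))) @ 0^' --> (v.1 * a + v.2 * b).
  apply: cvg_near_cst; near=> h.
  have h0 : h != 0 by near: h; exact: nbhs_dnbhs_neq.
  rewrite /shift /= !/(_ *: _) /=; by field.
split; first by apply/cvg_ex; eexists; exact: lim.
exact: cvg_lim lim.
Unshelve. all: by end_near. Qed.

Lemma has_grad_dxE f g1 g2 : has_grad f g1 g2 -> dx f = g1.
Proof.
move=> fg; apply/funext => x; rewrite /dx (@derive_val _ _ _ _ _ _ _ (fg x (1, 0))) /=.
by rewrite mul1r mul0r addr0.
Qed.

Lemma has_grad_dyE f g1 g2 : has_grad f g1 g2 -> dy f = g2.
Proof.
move=> fg; apply/funext => x; rewrite /dy (@derive_val _ _ _ _ _ _ _ (fg x (0, 1))) /=.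
by rewrite mul1r mul0r add0r.
Qed.

Lemma has_grad_deriveE f g1 g2 v : has_grad f g1 g2 ->
  'D_v f = fun x => v.1 * g1 x + v.2 * g2 x.
Proof. by move=> fg; apply/funext => x; exact: (@derive_val _ _ _ _ _ _ _ (fg x v)). Qed.

End Calculus.

Section LineAverage.
Variable R : realType.
Implicit Types (f g : plane R -> R) (u v x : plane R).

Lemma enorm_gt0 u : u != 0 -> 0 < enorm u.
Proof.
case: u => a b; rewrite -pair_eqE /= negb_and sqrtr_gt0 /dot /= -!expr2.
case/orP=> h; first by rewrite ltr_pwDl ?sqr_ge0// lt_neqAle sqr_ge0 eq_sym sqrf_eq0 h.
by rewrite ltr_wpDl ?sqr_ge0// lt_neqAle sqr_ge0 eq_sym sqrf_eq0 h.
Qed.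

Lemma enorm_sqr u : enorm u ^+ 2 = dot u u.
Proof. by rewrite sqr_sqrtr // /dot addr_ge0 // -expr2 sqr_ge0. Qed.

Lemma line_averageE u v f : u != v ->
  line_average u v f =
  \int[lebesgue_measure]_(t in `[0%R, 1%R]) f (u + t *: (v - u)).
Proof.
move=> uv; rewrite /line_average /line_integral mulrA mulVf ?mul1r//.
by rewrite gt_eqF// enorm_gt0// subr_eq0 eq_sym.
Qed.

Lemma continuous_lin c d f g : continuous f -> continuous g ->
  continuous (fun x => c * f x + d * g x).
Proof.
move=> cf cg x; apply: (@cvgD _ _ _ _ _ (fun x => c * f x) (fun x => d * g x)).
  by apply: cvgM; [exact: cvg_cst|exact: cf].
by apply: cvgM; [exact: cvg_cst|exact: cg].
Qed.

Lemma continuous_affine (c c1 c2 : R) :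
  continuous (fun x : plane R => c + (c1 * x.1 + c2 * x.2)).
Proof.
move=> x; apply: (@cvgD _ _ _ _ _ (fun=> c) (fun x => c1 * x.1 + c2 * x.2)).
  exact: cvg_cst.
by apply: continuous_lin => y; [exact: cvg_fst|exact: cvg_snd].
Qed.

Lemma continuous_along f u v : continuous f ->
  continuous (fun t : R => f (u + t *: v)).
Proof.
move=> cf t; apply: continuous_comp; last exact: cf.
by apply: cvgD; [exact: cvg_cst | apply: cvgZr_tmp; exact: cvg_id].
Qed.

Lemma integrable_along f u v : continuous f ->
  (@lebesgue_measure R).-integrable `[0%R, 1%R]
    (EFin \o (fun t : R => f (u + t *: v))).
Proof.
move=> cf; apply: continuous_compact_integrable; first exact: segment_compact.
by apply: continuous_subspaceT; exact: continuous_along.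
Qed.

Lemma line_averageD u v f g : u != v -> continuous f -> continuous g ->
  line_average u v (fun x => f x + g x) = line_average u v f + line_average u v g.
Proof.
move=> uv cf cg; rewrite !line_averageE// RintegralD//; exact: integrable_along.
Qed.

Lemma line_averageZ u v c f : u != v -> continuous f ->
  line_average u v (fun x => c * f x) = c * line_average u v f.
Proof.
move=> uv cf; rewrite !line_averageE// RintegralZl//; exact: integrable_along.
Qed.

Lemma line_average_lin u v c d f g : u != v -> continuous f -> continuous g ->
  line_average u v (fun x => c * f x + d * g x) =
  c * line_average u v f + d * line_average u v g.
Proof.
move=> uv cf cg; rewrite line_averageD ?line_averageZ// => x.
  by apply: cvgM; [exact: cvg_cst|exact: cf].
by apply: cvgM; [exact: cvg_cst|exact: cg].
Qed.

(** By the fundamental theorem of calculus, the average of a tangential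
    derivative only sees the two endpoints. *)
Lemma line_average_derive u v f g1 g2 : u != v ->
  has_grad f g1 g2 -> continuous g1 -> continuous g2 ->
  line_average u v ('D_(v - u) f) = f v - f u.
Proof.
move=> uv fg c1 c2; rewrite line_averageE//.
pose F (t : R) : R := f (u + t *: (v - u)).
have dF (t : R) : is_derive t (1 : R) F ('D_(v - u) f (u + t *: (v - u))).
  have [df _] := fg (u + t *: (v - u)) (v - u).
  have E : (fun h : R => h^-1 *: ((F \o shift t) (h *: 1) - F t)) =
      (fun h : R => h^-1 *: ((f \o shift (u + t *: (v - u))) (h *: (v - u)) -
        f (u + t *: (v - u)))).
    apply/funext => h; congr (_ *: (_ - _)); rewrite /F /=; congr f.
    by rewrite scalerDl addrCA [_ *: 1]mulr1.
  by split; rewrite /derivable /derive E.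
have cg : continuous (fun t : R => 'D_(v - u) f (u + t *: (v - u))).
  apply: (@continuous_along ('D_(v - u) f)); rewrite (has_grad_deriveE _ fg).
  exact: continuous_lin.
have cF : continuous F.
  by move=> t; apply: differentiable_continuous; apply/derivable1_diffP; case: (dF t).
rewrite /Rintegral (@continuous_FTC2 _ _ F)//.
- by rewrite /F scale1r scale0r addr0 subrKC.
- exact: continuous_subspaceT.
- split; first by move=> t _; case: (dF t).
  + by apply: cvg_at_right_filter; exact: cF.
  + by apply: cvg_at_left_filter; exact: cF.
- by move=> t _; rewrite derive1E; case: (dF t).
Qed.

End LineAverage.

(** * Local polynomial spaces and potentials *)

Section LocalSpaces.
Variable R : realType.
Implicit Types (f g : plane R -> R) (a : 'I_4 -> plane R).

Lemma poly_deg1P f : poly_deg 1 f <->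
  exists c0 c1 c2, f = fun x => c0 + (c1 * x.1 + c2 * x.2).
Proof.
split=> [[c ->]|[c0 [c1 [c2 ->]]]].
  exists (c 0 0)%N, (c 1 0)%N, (c 0 1)%N; apply/funext => x.
  by rewrite !(big_ord_recl, big_ord0) /=; ring.
exists (fun i j => nth 0 (nth [::] [:: [:: c0; c2]; [:: c1]] i) j).
by apply/funext => x; rewrite !(big_ord_recl, big_ord0) /=; ring.
Qed.

Lemma poly_deg2P f : poly_deg 2 f <->
  exists c0 c1 c2 c3 c4 c5, f = fun x => c0 + (c1 * x.1 + c2 * x.2) +
     (c3 * x.1 ^+ 2 + c4 * (x.1 * x.2) + c5 * x.2 ^+ 2).
Proof.
split=> [[c ->]|[c0 [c1 [c2 [c3 [c4 [c5 ->]]]]]]].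
  exists (c 0 0)%N, (c 1 0)%N, (c 0 1)%N, (c 2 0)%N, (c 1 1)%N, (c 0 2)%N.
  by apply/funext => x; rewrite !(big_ord_recl, big_ord0) /=; ring.
exists (fun i j => nth 0 (nth [::] [:: [:: c0; c2; c5]; [:: c1; c4]; [:: c3]] i) j).
by apply/funext => x; rewrite !(big_ord_recl, big_ord0) /=; ring.
Qed.

Definition rs_cross a := cross (quad_r a) (quad_s a).
(** The constant gradients of the coordinates [quad_xi] and [quad_eta]. *)
Definition xi1 a := - (quad_r a).2 / rs_cross a.
Definition xi2 a := (quad_r a).1 / rs_cross a.
Definition eta1 a := (quad_s a).2 / rs_cross a.
Definition eta2 a := - (quad_s a).1 / rs_cross a.

Lemma has_grad_xi a : has_grad (quad_xi a) (fun=> xi1 a) (fun=> xi2 a).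
Proof.
have -> : quad_xi a = fun x => (xi1 a * x.1 + xi2 a * x.2)
   + - (xi1 a * (quad_center a).1 + xi2 a * (quad_center a).2).
  by apply/funext => x; rewrite /quad_xi /xi1 /xi2 /rs_cross /cross /=; ring.
apply: has_grad_eq (has_gradD (has_grad_lin _ _) (has_grad_cst _)) _ _ => x;
  by rewrite addr0.
Qed.

Lemma has_grad_eta a : has_grad (quad_eta a) (fun=> eta1 a) (fun=> eta2 a).
Proof.
have -> : quad_eta a = fun x => (eta1 a * x.1 + eta2 a * x.2)
   + - (eta1 a * (quad_center a).1 + eta2 a * (quad_center a).2).
  by apply/funext => x; rewrite /quad_eta /eta1 /eta2 /rs_cross /cross /=; ring.
apply: has_grad_eq (has_gradD (has_grad_lin _ _) (has_grad_cst _)) _ _ => x;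
  by rewrite addr0.
Qed.

Lemma has_grad_fst : has_grad (fun x : plane R => x.1) (fun=> 1) (fun=> 0).
Proof.
rewrite (_ : (fun x => x.1) = fun x : plane R => 1 * x.1 + 0 * x.2).
  exact: has_grad_lin.
by apply/funext => x; ring.
Qed.

Lemma has_grad_snd : has_grad (fun x : plane R => x.2) (fun=> 0) (fun=> 1).
Proof.
rewrite (_ : (fun x => x.2) = fun x : plane R => 0 * x.1 + 1 * x.2).
  exact: has_grad_lin.
by apply/funext => x; ring.
Qed.

Lemma has_grad_P a p0 p1 p2 b c :
  has_grad (fun x => p0 + (p1 * x.1 + p2 * x.2) +
     b * quad_xi a x ^+ 2 + c * quad_eta a x ^+ 2)
   (fun x => p1 + 2 * b * xi1 a * quad_xi a x + 2 * c * eta1 a * quad_eta a x)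
   (fun x => p2 + 2 * b * xi2 a * quad_xi a x + 2 * c * eta2 a * quad_eta a x).
Proof.
apply: has_grad_eq (has_gradD (has_gradD (has_gradD (has_grad_cst _) (has_grad_lin _ _))
  (has_gradZ b (has_gradX 2 (has_grad_xi a))))
  (has_gradZ c (has_gradX 2 (has_grad_eta a)))) _ _ => x; rewrite /=; ring.
Qed.

Lemma has_grad_PM a c0 c1 c2 c3 c4 c5 b c :
  has_grad (fun x => c0 + (c1 * x.1 + c2 * x.2) +
     (c3 * x.1 ^+ 2 + c4 * (x.1 * x.2) + c5 * x.2 ^+ 2) +
     b * quad_xi a x ^+ 3 + c * quad_eta a x ^+ 3)
   (fun x => c1 + (2 * c3 * x.1 + c4 * x.2) +
      3 * b * xi1 a * quad_xi a x ^+ 2 + 3 * c * eta1 a * quad_eta a x ^+ 2)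
   (fun x => c2 + (c4 * x.1 + 2 * c5 * x.2) +
      3 * b * xi2 a * quad_xi a x ^+ 2 + 3 * c * eta2 a * quad_eta a x ^+ 2).
Proof.
apply: has_grad_eq (has_gradD (has_gradD (has_gradD (has_gradD (has_grad_cst _)
    (has_grad_lin _ _))
  (has_gradD (has_gradD (has_gradZ _ (has_gradX 2 has_grad_fst))
     (has_gradZ _ (has_gradM has_grad_fst has_grad_snd)))
     (has_gradZ _ (has_gradX 2 has_grad_snd))))
  (has_gradZ b (has_gradX 3 (has_grad_xi a))))
  (has_gradZ c (has_gradX 3 (has_grad_eta a)))) _ _ => x; rewrite /=; ring.
Qed.

Lemma P_quadP a f : P_quad a f <-> exists p0 p1 p2 b c,
  f = fun x => p0 + (p1 * x.1 + p2 * x.2) + b * quad_xi a x ^+ 2 + c * quad_eta a x ^+ 2.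
Proof.
split=> [[p /poly_deg1P[p0 [p1 [p2 ->]]] [b [c ->]]]|].
  by exists p0, p1, p2, b, c.
move=> [p0 [p1 [p2 [b [c ->]]]]].
exists (fun x => p0 + (p1 * x.1 + p2 * x.2)); last by exists b, c.
by apply/poly_deg1P; exists p0, p1, p2.
Qed.

Lemma PM_quadP a f : PM_quad a f <-> exists c0 c1 c2 c3 c4 c5 b c,
  f = fun x => c0 + (c1 * x.1 + c2 * x.2) +
     (c3 * x.1 ^+ 2 + c4 * (x.1 * x.2) + c5 * x.2 ^+ 2) +
     b * quad_xi a x ^+ 3 + c * quad_eta a x ^+ 3.
Proof.
split=> [[p /poly_deg2P[c0 [c1 [c2 [c3 [c4 [c5 ->]]]]]] [b [c ->]]]|].
  by exists c0, c1, c2, c3, c4, c5, b, c.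
move=> [c0 [c1 [c2 [c3 [c4 [c5 [b [c ->]]]]]]]].
exists (fun x => c0 + (c1 * x.1 + c2 * x.2) +
     (c3 * x.1 ^+ 2 + c4 * (x.1 * x.2) + c5 * x.2 ^+ 2)); last by exists b, c.
by apply/poly_deg2P; exists c0, c1, c2, c3, c4, c5.
Qed.

Lemma P_quad_continuous a f : P_quad a f -> continuous f.
Proof.
have caff c c1 c2 := @continuous_affine R c c1 c2.
have csq g : continuous g -> continuous (fun x => g x ^+ 2).
  by move=> cg x; apply: (@cvgM _ _ _ _ g g); exact: cg.
have cxi : continuous (quad_xi a).
  rewrite (_ : quad_xi a = fun x => - (xi1 a * (quad_center a).1 + xi2 a * (quad_center a).2)
    + (xi1 a * x.1 + xi2 a * x.2)); first exact: caff.
  by apply/funext => x; rewrite /quad_xi /xi1 /xi2 /rs_cross /cross /=; ring.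
have ceta : continuous (quad_eta a).
  rewrite (_ : quad_eta a = fun x => - (eta1 a * (quad_center a).1 + eta2 a * (quad_center a).2)
    + (eta1 a * x.1 + eta2 a * x.2)); first exact: caff.
  by apply/funext => x; rewrite /quad_eta /eta1 /eta2 /rs_cross /cross /=; ring.
move=> /P_quadP[p0 [p1 [p2 [b [c ->]]]]].
rewrite (_ : (fun _ => _) = fun x => 1 * (1 * (p0 + (p1 * x.1 + p2 * x.2)) +
     b * quad_xi a x ^+ 2) + c * quad_eta a x ^+ 2).
  by apply: continuous_lin (csq _ ceta); apply: continuous_lin (csq _ cxi).
by apply/funext => x; ring.
Qed.

(** A cube differentiates to a square times a constant, so differentiation maps
    the local Morley space into the local nonconforming space; the divergence of
    a curl vanishes because mixed derivatives commute. *)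
Lemma curl_PM a f : PM_quad a f ->
  [/\ P_quad a (dx f), P_quad a (dy f), has_grad f (dx f) (dy f) &
      div (curl f) = fun=> 0].
Proof.
move=> /PM_quadP[c0 [c1 [c2 [c3 [c4 [c5 [b [c ->]]]]]]]].
have fg := has_grad_PM a c0 c1 c2 c3 c4 c5 b c.
have Ex := has_grad_dxE fg; have Ey := has_grad_dyE fg.
split; first by rewrite Ex; apply/P_quadP; do 5 eexists.
- by rewrite Ey; apply/P_quadP; do 5 eexists.
- by rewrite Ex Ey.
- apply/funext => x; rewrite /div /curl /= Ey Ex.
  rewrite (has_grad_dxE (has_grad_P _ _ _ _ _ _)).
  under [X in dy X]eq_fun do rewrite -mulN1r.
  rewrite (has_grad_dyE (has_gradZ (-1) (has_grad_P _ _ _ _ _ _))); ring.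
Qed.

(** Evaluation at the centre and at one point on each axis isolates the
    coefficients. *)
Lemma xi_eta_indep a : convex_quad a -> forall c d e : R,
  (forall x, c + d * quad_xi a x + e * quad_eta a x = 0) -> [/\ c = 0, d = 0 & e = 0].
Proof.
move=> aP c d e h.
have := h (quad_center a + 0 *: quad_r a + 0 *: quad_s a).
have := h (quad_center a + 1 *: quad_r a + 0 *: quad_s a).
have := h (quad_center a + 0 *: quad_r a + 1 *: quad_s a).
rewrite !quad_xiE// !quad_etaE// !mulr0 !mulr1 !addr0 => h1 h2 c0.
by move: h1 h2; rewrite c0 !add0r.
Qed.

(** As [quad_xi] and [quad_eta] are independent, a vanishing divergence splits
    into three conditions: the linear part is trace free, and the coefficient
    vector of xi^2 (of eta^2) is orthogonal to the gradient of xi (of eta), that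
    is, parallel to curl xi (to curl eta).  Each part then has its own potential,
    xi^2 curl xi being the curl of xi^3 / 3. *)
Lemma potential a f g : convex_quad a -> P_quad a f -> P_quad a g ->
  div (fun x => (f x, g x)) = (fun=> 0) ->
  exists2 phi, PM_quad a phi & curl phi = fun x => (f x, g x).
Proof.
move=> aP /P_quadP[p0 [p1 [p2 [b [c ->]]]]] /P_quadP[q0 [q1 [q2 [b' [c' ->]]]]] dv.
have [tr xi0 eta0] : [/\ p1 + q2 = 0, 2 * (b * xi1 a + b' * xi2 a) = 0 &
    2 * (c * eta1 a + c' * eta2 a) = 0].
  apply: (xi_eta_indep aP) => x.
  have := congr1 (fun F => F x) dv; rewrite /div /=.
  rewrite (has_grad_dxE (has_grad_P _ _ _ _ _ _)) (has_grad_dyE (has_grad_P _ _ _ _ _ _)) => <-.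
  ring.
have ne : rs_cross a != 0 by rewrite gt_eqF// cross_rs_gt0.
have N1 : xi1 a ^+ 2 + xi2 a ^+ 2 != 0.
  apply: contraNneq ne => /eqP; rewrite paddr_eq0 ?sqr_ge0// !sqrf_eq0 => /andP[h1 h2].
  apply/eqP; have : rs_cross a * (xi2 a * (quad_s a).2 + xi1 a * (quad_s a).1) = rs_cross a.
    rewrite /xi1 /xi2 [in RHS]/rs_cross /cross; field.
    exact: lt0r_neq0 (cross_rs_gt0 aP).
  by rewrite (eqP h1) (eqP h2) !mul0r addr0 mulr0.
have N2 : eta1 a ^+ 2 + eta2 a ^+ 2 != 0.
  apply: contraNneq ne => /eqP; rewrite paddr_eq0 ?sqr_ge0// !sqrf_eq0 => /andP[h1 h2].
  apply/eqP; have : rs_cross a * (eta2 a * (quad_r a).2 + eta1 a * (quad_r a).1) = rs_cross a.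
    rewrite /eta1 /eta2 [in RHS]/rs_cross /cross; field.
    exact: lt0r_neq0 (cross_rs_gt0 aP).
  by rewrite (eqP h1) (eqP h2) !mul0r addr0 mulr0.
(* In the plane, a vector orthogonal to (u, v) is a multiple of (v, - u). *)
have par (u v r s : R) : u ^+ 2 + v ^+ 2 != 0 -> 2 * (r * u + s * v) = 0 ->
    let l := (r * v - s * u) / (u ^+ 2 + v ^+ 2) in r = l * v /\ s = - (l * u).
  move=> N h l; have h2 : r * u + s * v = 0.
    by move/eqP: h; rewrite mulf_eq0 pnatr_eq0 /= => /eqP.
  split; apply: (mulIf N); rewrite /l.
    rewrite mulrAC divfK//; apply/eqP; rewrite -subr_eq0; apply/eqP.
    by transitivity (u * (r * u + s * v)); [ring|rewrite h2 mulr0].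
  rewrite mulNr mulrAC divfK//; apply/eqP; rewrite -subr_eq0; apply/eqP.
  by transitivity (v * (r * u + s * v)); [ring|rewrite h2 mulr0].
have [bE b'E] := par _ _ _ _ N1 xi0.
have [cE c'E] := par _ _ _ _ N2 eta0.
move: bE b'E cE c'E; set l := _ / _; set m := _ / _ => bE b'E cE c'E.
have q2E : q2 = - p1 by apply/eqP; rewrite -addr_eq0 addrC tr.
have fg := has_grad_PM a 0 (- q0) p0 (- q1 / 2) p1 (p2 / 2) (l / 3) (m / 3).
eexists; first by apply/PM_quadP; exists 0, (- q0), p0, (- q1 / 2), p1, (p2 / 2), (l / 3), (m / 3).
apply/funext => x; rewrite /curl (has_grad_dyE fg) (has_grad_dxE fg) q2E bE b'E cE c'E.
by congr pair; field.
Qed.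

End LocalSpaces.

(** * Convex quadrilaterals *)

Section QuadGeometry.
Variable R : realType.
Implicit Types (a : 'I_4 -> plane R) (x y u v p q : plane R) (i j : 'I_4).

Lemma ordS4 i : ordS (ordS (ordS (ordS i))) = i.
Proof. by apply: val_inj; case: i => [[|[|[|[|]]]]]. Qed.

Lemma ord4_ind (P : 'I_4 -> Prop) i :
  P i -> P (ordS i) -> P (ordS (ordS i)) -> P (ordS (ordS (ordS i))) -> forall j, P j.
Proof.
move=> p0 p1 p2 p3 j.
have : j \in [:: i; ordS i; ordS (ordS i); ordS (ordS (ordS i))].
  by rewrite !inE -!val_eqE; case: i {p0 p1 p2 p3} => [[|[|[|[|]]]]] //= _;
    case: j => [[|[|[|[|]]]]].
by rewrite !inE => /or4P[] /eqP->.
Qed.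

Lemma sum_ord4 (V : nmodType) (F : 'I_4 -> V) i :
  \sum_j F j = F i + F (ordS i) + F (ordS (ordS i)) + F (ordS (ordS (ordS i))).
Proof.
rewrite (bigD1 i)//= (bigD1 (ordS i))/=; last first.
  by rewrite -val_eqE; case: i => [[|[|[|[|]]]]].
rewrite (bigD1 (ordS (ordS i)))/=; last first.
  by rewrite -!val_eqE; case: i => [[|[|[|[|]]]]].
rewrite (bigD1 (ordS (ordS (ordS i))))/=; last first.
  by rewrite -!val_eqE; case: i => [[|[|[|[|]]]]].
rewrite big1 ?addr0 ?addrA// => j.
move: j; apply: (@ord4_ind _ i); rewrite !eqxx ?andbF//.
Qed.

Lemma ordS_neq i : ordS i != i.
Proof. by rewrite -val_eqE; case: i => [[|[|[|[|]]]]]. Qed.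

Lemma ordSS_neq i : ordS (ordS i) != i.
Proof. by rewrite -val_eqE; case: i => [[|[|[|[|]]]]]. Qed.

(** Signed distance to the line through an edge, up to a positive factor: it is
    positive on the left of the edge, where a convex quadrilateral lies. *)
Definition side a i x : R := cross (a (ordS i) - a i) (x - a i).

Lemma side_vertex a i : side a i (a i) = 0.
Proof. by rewrite /side /cross /=; ring. Qed.

Lemma side_vertexS a i : side a i (a (ordS i)) = 0.
Proof. by rewrite /side /cross /=; ring. Qed.

Lemma side_segment a i u v (t : R) :
  side a i (u + t *: (v - u)) = (1 - t) * side a i u + t * side a i v.
Proof. by rewrite /side /cross /= /GRing.scale /=; ring. Qed.

Section Convex.
Variable a : 'I_4 -> plane R.
Hypothesis aP : convex_quad a.

Lemma side_vertexSS i : 0 < side a i (a (ordS (ordS i))).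
Proof. by have := aP i; congr (_ < _); rewrite /side /cross /=; ring. Qed.

Lemma side_vertexSSS i : 0 < side a i (a (ordS (ordS (ordS i)))).
Proof.
by have := aP (ordS (ordS (ordS i))); rewrite ordS4; congr (_ < _);
  rewrite /side /cross /=; ring.
Qed.

Lemma side_vertex_ge0 i j : 0 <= side a i (a j).
Proof.
move: j; apply: (@ord4_ind _ i); first by rewrite side_vertex.
- by rewrite side_vertexS.
- exact: ltW (side_vertexSS i).
- exact: ltW (side_vertexSSS i).
Qed.

Lemma side_comb i (t : 'I_4 -> R) : \sum_j t j = 1 ->
  side a i (\sum_j t j *: a j) = \sum_j t j * side a i (a j).
Proof.
move=> t1; have t0 : t i = 1 - (t (ordS i) + t (ordS (ordS i)) + t (ordS (ordS (ordS i)))).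
  by rewrite -t1 (sum_ord4 _ i); ring.
by rewrite !(sum_ord4 _ i) /side /cross /= /GRing.scale /= t0; ring.
Qed.

Lemma vertex_neqS i : a i != a (ordS i).
Proof.
apply: contraTneq (aP i) => ->.
by rewrite subrr /cross /= !mul0r subr0 ltxx.
Qed.

Lemma vertex_inj : injective a.
Proof.
move=> i j; move: j i.
have h i : a i != a (ordS i) /\ a i != a (ordS (ordS i)).
  split; first exact: vertex_neqS.
  by apply: contraTneq (side_vertexSS i) => <-; rewrite side_vertex ltxx.
move=> j; apply: (@ord4_ind _ j) => // /eqP.
- by rewrite eq_sym (negbTE (h j).1).
- by rewrite eq_sym (negbTE (h j).2).
- by have [+ _] := h (ordS (ordS (ordS j))); rewrite ordS4 => /negbTE->.
Qed.

(** The diagonal through the first and third vertices cuts the quadrilateral into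
    two triangles.  In the triangle on the side of [x], the barycentric
    coordinates of [x] are ratios of signed areas, each nonnegative by hypothesis
    or by the choice of the triangle. *)
Lemma quad_regionP x : quad_region a x <-> forall i, 0 <= side a i x.
Proof.
split=> [[t [t0 t1 ->]] i|h].
  by rewrite side_comb// sumr_ge0// => j _; rewrite mulr_ge0// side_vertex_ge0.
pose i0 := (ord0 : 'I_4); pose i1 := ordS i0; pose i2 := ordS i1; pose i3 := ordS i2.
have e3 : ordS i3 = i0 by exact: ordS4.
have D1 := side_vertexSS i0. have D2 := side_vertexSS i2.
have mk (w : R * R * R * R) : 0 <= w.1.1.1 -> 0 <= w.1.1.2 -> 0 <= w.1.2 -> 0 <= w.2 ->
    w.1.1.1 + w.1.1.2 + w.1.2 + w.2 = 1 ->
    x = w.1.1.1 *: a i0 + w.1.1.2 *: a i1 + w.1.2 *: a i2 + w.2 *: a i3 -> quad_region a x.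
  move=> w0 w1 w2 w3 w4 ->.
  exists (fun i => nth 0 [:: w.1.1.1; w.1.1.2; w.1.2; w.2] i); split.
  - by apply: (@ord4_ind _ i0).
  - by rewrite (sum_ord4 _ i0).
  - by rewrite (sum_ord4 _ i0).
have := h i0; have := h i1; have := h i2; have := h i3.
have := D1; have := D2; rewrite /side -/i1 -/i2 -/i3 !e3.
move: mk; case: (a i0) (a i1) (a i2) (a i3) x {h D1 D2} =>
  [x0 y0] [x1 y1] [x2 y2] [x3 y3] [x y] mk.
have [d|d] := lerP 0 (cross ((x2, y2) - (x0, y0)) ((x, y) - (x0, y0))).
  set D := cross _ _ => D0 _ s3 s2 _ _.
  have Dn0 : (x3 - x2) * (y0 - y2) - (y3 - y2) * (x0 - x2) != 0 by exact: lt0r_neq0 D0.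
  apply: (mk ((cross ((x3, y3) - (x2, y2)) ((x, y) - (x2, y2)) / D, 0,
     cross ((x0, y0) - (x3, y3)) ((x, y) - (x3, y3)) / D),
     cross ((x2, y2) - (x0, y0)) ((x, y) - (x0, y0)) / D)) => //=.
  - by rewrite divr_ge0 // ltW.
  - by rewrite divr_ge0 // ltW.
  - by rewrite divr_ge0 // ltW.
  - by rewrite /D /cross /=; field.
  - by congr pair; rewrite /D /cross /= /GRing.scale /=; field.
move=> _; set D := cross _ _ => D0 _ _ s1 s0.
have Dn0 : (x1 - x0) * (y2 - y0) - (y1 - y0) * (x2 - x0) != 0 by exact: lt0r_neq0 D0.
apply: (mk ((cross ((x2, y2) - (x1, y1)) ((x, y) - (x1, y1)) / D,
     - cross ((x2, y2) - (x0, y0)) ((x, y) - (x0, y0)) / D,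
     cross ((x1, y1) - (x0, y0)) ((x, y) - (x0, y0)) / D), 0)) => //=.
- by rewrite divr_ge0 // ltW.
- by rewrite divr_ge0 ?oppr_ge0// ltW.
- by rewrite divr_ge0 // ltW.
- by rewrite /D /cross /=; field.
- by congr pair; rewrite /D /cross /= /GRing.scale /=; field.
Qed.

Lemma segmentP u v x : segment u v x <->
  exists2 t : R, 0 <= t <= 1 & x = u + t *: (v - u).
Proof.
split=> [[t /= t01 <-]|[t t01 ->]]; last by exists t => //=; rewrite in_itv.
by exists t => //; move: t01; rewrite in_itv.
Qed.

Lemma edge_side i x : quad_edge a i x -> side a i x = 0.
Proof.
move=> /segmentP[t _ ->]; rewrite side_segment side_vertex side_vertexS; ring.
Qed.

Lemma edge_region i x : quad_edge a i x -> quad_region a x.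
Proof.
move=> /segmentP[t /andP[t0 t1] ->]; apply/quad_regionP => j.
by rewrite side_segment; apply: addr_ge0; apply: mulr_ge0; rewrite ?side_vertex_ge0// subr_ge0.
Qed.

(** Of the four vertices, only the two ends of the edge lie on its line; all others
    must have weight 0. *)
Lemma region_side0 i x : quad_region a x -> side a i x = 0 -> quad_edge a i x.
Proof.
move=> [t [t0 t1 ->]]; rewrite side_comb//.
rewrite (sum_ord4 _ i) side_vertex side_vertexS !mulr0 !add0r => /eqP.
have h2 := side_vertexSS i; have h3 := side_vertexSSS i.
rewrite paddr_eq0 ?mulr_ge0// 1?ltW// !mulf_eq0 !(gt_eqF h2, gt_eqF h3) !orbF.
move=> /andP[/eqP t2 /eqP t3]; apply/segmentP; exists (t (ordS i)).
  by rewrite t0 -t1 (sum_ord4 _ i) t2 t3 !addr0 lerDr t0.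
have tE : t i = 1 - t (ordS i).
  by rewrite -t1 (sum_ord4 _ i) t2 t3; ring.
rewrite (sum_ord4 _ i) t2 t3 tE !scale0r !addr0.
by rewrite scalerBr scalerBl scale1r addrAC addrA.
Qed.

Lemma relint_side i j (t : R) : 0 < t < 1 -> j != i ->
  0 < side a j (a i + t *: (a (ordS i) - a i)).
Proof.
move=> /andP[t0 t1]; rewrite side_segment; move: j i.
have t1' : 0 < 1 - t by rewrite subr_gt0.
move=> j; apply: (@ord4_ind _ j) => [|_|_|_]; first by rewrite eqxx.
- by rewrite side_vertexS mulr0 add0r mulr_gt0// side_vertexSS.
- by rewrite addr_gt0// mulr_gt0// ?side_vertexSS ?side_vertexSSS.
- by rewrite ordS4 side_vertex mulr0 addr0 mulr_gt0// side_vertexSSS.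
Qed.

Lemma edge_relint i x : quad_edge a i x -> x != a i -> x != a (ordS i) ->
  forall j, j != i -> 0 < side a j x.
Proof.
move=> /segmentP[t /andP[t0 t1] ->] n0 n1 j ji; apply: relint_side => //.
rewrite !lt_neqAle t0 t1 !andbT; apply/andP; split.
  by apply: contraNneq n0 => <-; rewrite scale0r addr0.
by apply: contraNneq n1 => ->; rewrite scale1r subrKC.
Qed.

Lemma side_gt0_neq i x : 0 < side a i x -> x != a i.
Proof. by apply: contraTneq => ->; rewrite side_vertex ltxx. Qed.

Lemma side_gt0_neqS i x : 0 < side a i x -> x != a (ordS i).
Proof. by apply: contraTneq => ->; rewrite side_vertexS ltxx. Qed.

Lemma relint_not_vertex i (t : R) j : 0 < t < 1 -> a i + t *: (a (ordS i) - a i) != a j.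
Proof.
move=> t01; have [->|ji] := eqVneq j i; last exact: side_gt0_neq (relint_side t01 ji).
have := side_gt0_neqS (relint_side t01 (j := ordS (ordS (ordS i))) _).
rewrite ordS4; apply; rewrite -{2}(ordS4 i) eq_sym; exact: ordS_neq.
Qed.

Definition quad_inner : plane R := midpoint (a ord0) (a (ordS (ordS ord0))).

Lemma quad_inner_side i : 0 < side a i quad_inner.
Proof.
have -> : quad_inner = a ord0 + 2^-1 *: (a (ordS (ordS ord0)) - a ord0).
  have half : 1 = 2^-1 + 2^-1 :> R by field.
  rewrite /quad_inner /midpoint -[X in _ = X + _]scale1r {2}half scalerDl scalerBr.
  by rewrite addrACA subrr addr0 scalerDr.
rewrite side_segment; have h : 0 < 1 - 2^-1 :> R by lra.
have s1 := side_vertexSSS (ordS ord0); have s2 := side_vertexSS (ordS (ordS ord0)).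
have s3 := side_vertexSSS (ordS (ordS (ordS ord0))).
have z3 := side_vertexS a (ordS (ordS (ordS ord0))).
move: s1 s2 s3 z3; rewrite !ordS4 => s1 s2 s3 z3.
move: i; apply: (@ord4_ind _ ord0).
- by rewrite side_vertex mulr0 add0r mulr_gt0// side_vertexSS.
- by rewrite side_vertexS mulr0 addr0 mulr_gt0.
- by rewrite side_vertex mulr0 addr0 mulr_gt0.
- by rewrite z3 mulr0 add0r mulr_gt0.
Qed.

End Convex.

(** The ends of a segment are its extreme points: expressing each pair of ends
    through the other one forces all parameters to be 0 or 1. *)
Lemma segment_eq u v p q : u != v -> segment u v = segment p q ->
  (u = p /\ v = q) \/ (u = q /\ v = p).
Proof.
move=> uv E.
have endl (c d : plane R) : segment c d c.
  by apply/segmentP; exists 0; rewrite ?lexx ?ler01// scale0r addr0.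
have endr (c d : plane R) : segment c d d.
  by apply/segmentP; exists 1; rewrite ?lexx ?ler01// scale1r subrKC.
have := endl u v; rewrite E => /segmentP[s /andP[s0 s1] us].
have := endr u v; rewrite E => /segmentP[t /andP[t0 t1] vt].
have := endl p q; rewrite -E => /segmentP[w /andP[w0 w1] pw].
have := endr p q; rewrite -E => /segmentP[z /andP[z0 z1] qz].
have D0 : q - p != 0.
  by apply: contra_neq uv => D0; rewrite us vt D0 !scaler0.
have scal_inj (c d : R) : c *: (q - p) = d *: (q - p) -> c = d.
  move=> /eqP; rewrite -subr_eq0 -scalerBl scaler_eq0 (negbTE D0) orbF subr_eq0.
  by move=> /eqP.
have vu : v - u = (t - s) *: (q - p).
  by rewrite vt {1}us opprD addrACA subrr add0r scalerBl.
have up : u - p = s *: (q - p) by rewrite {1}us addrC addKr.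
have e1 : s + w * (t - s) = 0.
  apply: scal_inj; rewrite scale0r.
  have : p - p = (u - p) + w *: (v - u) by rewrite {1}pw addrAC.
  by rewrite subrr vu up scalerA -scalerDl => /esym.
have e2 : s + z * (t - s) = 1.
  apply: scal_inj; rewrite scale1r.
  have : q - p = (u - p) + z *: (v - u) by rewrite {1}qz addrAC.
  by rewrite vu up scalerA -scalerDl => /esym.
have [s00|sn0] := eqVneq s 0.
  left; split; first by rewrite us s00 scale0r addr0.
  have : t = 1 by nra.
  by move=> t1'; rewrite vt t1' scale1r subrKC.
right.
have w11 : w = 1.
  have : s * (1 - w) = 0 by nra.
  by move/eqP; rewrite mulf_eq0 (negbTE sn0) subr_eq0 => /eqP.
have t00 : t = 0 by move: e1; rewrite w11; lra.
have s11 : s = 1 by nra.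
by split; [rewrite us s11 scale1r subrKC|rewrite vt t00 scale0r addr0].
Qed.

End QuadGeometry.

(** * Topology of the plane and of Lipschitz domains *)

Section PlaneTopology.
Variable R : realType.
Implicit Types (x p q u v w : plane R) (C D U : set (plane R)).

Lemma continuous_cross u p : continuous (fun x => cross u (x - p)).
Proof.
rewrite (_ : (fun x => _) = fun x => (u.2 * p.1 - u.1 * p.2) + (- u.2 * x.1 + u.1 * x.2)).
  exact: continuous_affine.
by apply/funext => x; rewrite /cross /=; ring.
Qed.

Lemma continuous_dot u p : continuous (fun x => dot (x - p) u).
Proof.
rewrite (_ : (fun x => _) = fun x => - (p.1 * u.1 + p.2 * u.2) + (u.1 * x.1 + u.2 * x.2)).
  exact: continuous_affine.
by apply/funext => x; rewrite /dot /=; ring.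
Qed.

Lemma near_gt (f : plane R -> R) x c : continuous f -> c < f x ->
  \forall y \near x, c < f y.
Proof. by move=> cf cx; have /cvgr_gt := cf x; apply. Qed.

Lemma near_lt (f : plane R -> R) x c : continuous f -> f x < c ->
  \forall y \near x, f y < c.
Proof. by move=> cf cx; have /cvgr_lt := cf x; apply. Qed.

Lemma near_all (I : finType) (P : I -> plane R -> Prop) x :
  (forall i, \forall y \near x, P i y) -> \forall y \near x, forall i, P i y.
Proof. exact: (@filter_forall _ I P (nbhs x)). Qed.

Lemma near_line U p v : nbhs p U -> \forall t \near (0 : R), U (p + t *: v).
Proof.
move=> Up; have h : (fun t : R => p + t *: v) @ (0 : R) --> p.
  rewrite -[X in _ --> X]addr0 -(scale0r v).
  by apply: cvgD; [exact: cvg_cst | apply: cvgZr_tmp; exact: cvg_id].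
exact: h.
Qed.

Lemma near_line_right U p v : nbhs p U -> \forall t \near (0 : R)^'+, U (p + t *: v).
Proof. by move=> /(near_line v) h; apply: cvg_at_right_filter h; exact: cvg_id. Qed.

(** Along a segment, membership in a closed set cannot change without leaving
    the union of the two closed sets or meeting their intersection. *)
Lemma segment_clopen C D p q : closed C -> closed D ->
  (forall t : R, 0 <= t <= 1 -> C (p + t *: (q - p)) \/ D (p + t *: (q - p))) ->
  (forall t : R, 0 <= t <= 1 -> C (p + t *: (q - p)) -> ~ D (p + t *: (q - p))) ->
  C p -> C q.
Proof.
move=> cC cD CD CnD Cp; pose g (t : R) := p + t *: (q - p).
have cg : continuous g.
  by move=> t; apply: cvgD; [exact: cvg_cst | apply: cvgZr_tmp; exact: cvg_id].
have E : `[0, 1] `&` g @^-1` C = `[0, 1]%classic.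
  apply: (@segment_connected R 0 1).
  - by exists 0; split => /=; rewrite ?in_itv /= ?lexx ?ler01// /g scale0r addr0.
  - exists (g @^-1` (~` D)).
      by apply: open_comp => //; exact: closed_openC.
    apply/seteqP; split => t /=; rewrite in_itv /= => -[t01 h]; split => //.
      exact: CnD.
    by case: (CD t t01).
  - by exists (g @^-1` C) => //; exact: preimage_closed.
have : `[0%R, 1%R]%classic (1 : R) by rewrite /= in_itv /= ler01 lexx.
by rewrite -E => -[_]; rewrite /g /= scale1r subrKC.
Qed.

Lemma ball_convex x (e : R) p q (t : R) : 0 <= t <= 1 ->
  ball x e p -> ball x e q -> ball x e (p + t *: (q - p)).
Proof.
rewrite -ball_normE /= => /andP[t0 t1] hp hq.
have -> : x - (p + t *: (q - p)) = (1 - t) *: (x - p) + t *: (x - q).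
  rewrite scalerBl scale1r opprD addrA -[RHS]addrA; congr (_ + _).
  by rewrite -!scalerN -scalerDr !opprB addrA addrNK.
apply: le_lt_trans (ler_normD _ _) _; rewrite !normrZ (ger0_norm t0) ger0_norm ?subr_ge0//.
have [->|tn0] := eqVneq t 0; first by rewrite subr0 mul1r mul0r addr0.
have tp : 0 < t by rewrite lt_neqAle eq_sym tn0.
have h1 : (1 - t) * `|x - p| <= (1 - t) * e by rewrite ler_wpM2l ?subr_ge0// ltW.
have h2 : t * `|x - q| < t * e by rewrite ltr_pM2l.
by have := ler_ltD h1 h2; rewrite -mulrDl subrK mul1r.
Qed.

Lemma dot_gt0 u : u != 0 -> 0 < dot u u.
Proof. by move=> /enorm_gt0; rewrite -enorm_sqr => h; rewrite exprn_gt0. Qed.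

Lemma cross_rot90 u : cross u (rot90 u) = dot u u.
Proof. by rewrite /cross /dot /=; ring. Qed.

(** A punctured disc is connected: two of its points are joined by a segment or,
    if the centre lies between them, by two segments through a third point off
    their line. *)
Lemma punctured_ball C D x U : closed C -> closed D -> nbhs x U ->
  (forall y, U y -> y != x -> C y \/ D y) ->
  (forall y, U y -> y != x -> C y -> ~ D y) ->
  nbhs x C \/ nbhs x D.
Proof.
move=> cC cD /nbhs_ballP[e /= e0 eU] CD CnD.
have key : forall E F p q, closed E -> closed F ->
    (forall y, U y -> y != x -> E y \/ F y) ->
    (forall y, U y -> y != x -> E y -> ~ F y) ->
    ball x e p -> p != x -> ball x e q -> q != x -> E p -> E q.
  move=> E F p q cE cF EF EnF bp px bq qx.
  have seg r s : ball x e r -> ball x e s -> (forall t : R, 0 <= t <= 1 -> r + t *: (s - r) != x) ->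
      E r -> E s.
    move=> br bs rsx; apply: (segment_clopen cE cF) => t t01.
      by apply: EF (rsx _ t01); apply: eU; exact: ball_convex.
    by apply: EnF (rsx _ t01); apply: eU; exact: ball_convex.
  have [on|off] := pselect (exists2 t : R, 0 <= t <= 1 & p + t *: (q - p) = x); last first.
    by apply: seg => // t t01; apply/eqP => h; apply: off; exists t.
  case: on => t0 _ xE.
  have pq : q - p != 0.
    by apply: contra_neq px => pq; rewrite -xE pq scaler0 addr0.
  (* A detour: r lies near the centre, perpendicularly to the line p q. *)
  have [d [d0 bd]] : exists d : R, 0 < d /\ ball x e (x + d *: rot90 (q - p)).
    have : \forall d \near (0:R)^'+, 0 < d /\ ball x e (x + d *: rot90 (q - p)).
      near=> d; split; first by near: d; exact: nbhs_right_gt.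
      by near: d; apply: near_line_right; exact: nbhsx_ballx.
    by move=> /filter_ex[d]; exists d.
  set r := x + d *: _ in bd.
  have c0 : cross (q - p) (x - p) = 0.
    by rewrite -xE /cross /= !/(_ *: _) /=; ring.
  have c0' : cross (q - p) (x - q) = 0.
    by rewrite -xE /cross /= !/(_ *: _) /=; ring.
  have cr : 0 < cross (q - p) (r - x).
    have -> : cross (q - p) (r - x) = d * cross (q - p) (rot90 (q - p)).
      by rewrite /r /cross /= !/(_ *: _) /=; ring.
    by rewrite cross_rot90 mulr_gt0// dot_gt0.
  have off (s : plane R) (t : R) : cross (q - p) (x - s) = 0 -> s != x -> s + t *: (r - s) != x.
    move=> cs sx; apply: contra_neq sx => e'.
    have : t * cross (q - p) (r - x) = 0.
      transitivity (cross (q - p) (s + t *: (r - s) - s) + t * cross (q - p) (s - x)).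
        by rewrite /cross /= !/(_ *: _) /=; ring.
      have c2 : cross (q - p) (s - x) = - cross (q - p) (x - s).
        by rewrite /cross /=; ring.
      by rewrite e' c2 cs oppr0 mulr0 addr0.
    move/eqP; rewrite mulf_eq0 (gt_eqF cr) orbF => /eqP t00.
    by rewrite -e' t00 scale0r addr0.
  move=> Ep; apply: (seg r) => //; last first.
    by apply: (seg p r) => // t _; exact: off.
  move=> t _.
  have -> : r + t *: (q - r) = q + (1 - t) *: (r - q).
    by rewrite scalerBl scale1r addrA subrKC -scalerN opprB.
  exact: off.
have [q [bq qx]] : exists q, ball x e q /\ q != x.
  have : \forall d \near (0:R)^'+, ball x e (x + d *: ((1, 0) : plane R)) /\ 0 < d.
    near=> d; split; last by near: d; exact: nbhs_right_gt.
    by near: d; apply: near_line_right; exact: nbhsx_ballx.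
  move=> /filter_ex[d [bd d0]]; exists (x + d *: (1, 0)); split => //.
  apply/eqP => /(congr1 fst) /= /eqP; rewrite -subr_eq0 addrAC subrr add0r.
  by rewrite /GRing.scale /= mulr1 gt_eqF.
have fin E : closed E -> (forall y, ball x e y -> y != x -> E y) -> nbhs x E.
  move=> cE Ey; apply/nbhs_ballP; exists e => //= y xy.
  have [yx|] := eqVneq y x; last exact: Ey.
  apply: cE => B; rewrite yx => /(near_line_right (1, 0)) xB.
  have : \forall d \near (0:R)^'+, [/\ ball x e (x + d *: ((1, 0) : plane R)),
      0 < d & B (x + d *: ((1, 0) : plane R))].
    near=> d; split; last by near: d.
      by near: d; apply: near_line_right; exact: nbhsx_ballx.
    by near: d; exact: nbhs_right_gt.
  move=> /filter_ex[d [bd d0 Bd]]; exists (x + d *: (1, 0)); split => //.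
  apply: Ey => //.
  apply/eqP => /(congr1 fst) /= /eqP; rewrite -subr_eq0 addrAC subrr add0r.
  by rewrite /GRing.scale /= mulr1 gt_eqF.
have [Cq|Dq] := CD q (eU _ bq) qx.
  by left; apply: fin => // y by_ yx; exact: (key C D q y).
right; apply: fin => // y by_ yx; apply: (key D C q y) => //.
  by move=> z Uz zx; have [] := CD z Uz zx; tauto.
by move=> z Uz zx Dz Cz; exact: (CnD z Uz zx Cz Dz).
Unshelve. all: by end_near. Qed.

(** Below its graph a Lipschitz domain has an exterior, so that no boundary
    point is swallowed when passing to the closure. *)
Lemma boundary_not_interior_closure Om p :
  lipschitz_domain Om -> boundary Om p -> ~ interior (closure Om) p.
Proof.
move=> [_ oOm _ _ lip] Bp; have [u [d [L [g [u1 d0 gL gE]]]]] := lip p Bp.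
have uu : dot u u = 1 by rewrite -enorm_sqr u1 expr1n.
have nOp : ~ Om p by move=> Op; case: Bp => _; apply; exact: open_nbhs_nbhs.
have g0 : 0 <= g 0.
  rewrite leNgt; apply/negP => g0; apply: nOp.
  by have /gE := g0; rewrite !scale0r !addr0 normr0; apply.
pose s y := dot (y - p) u; pose t y := dot (y - p) (rot90 u).
have co y : y = p + s y *: u + t y *: rot90 u.
  have : y - p = s y *: u + t y *: rot90 u.
    rewrite /s /t {u1 gE s t}; case: (y - p) u uu => [a b] [c e]; rewrite /dot /= => uu.
    congr pair; rewrite !/(_ *: _) /= !/(_ *: _) /=.
      transitivity (a * (c * c + e * e)); first by rewrite uu mulr1.
      ring.
    transitivity (b * (c * c + e * e)); first by rewrite uu mulr1.
    ring.
  by move=> h; rewrite -addrA -h subrKC.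
(* The points q straight below p lie under the graph, even in a cone, hence
   outside the closure. *)
move=> /(near_line (rot90 u)) h.
have : \forall a \near (0:R)^'-, [/\ closure Om (p + a *: rot90 u), a < 0 & - d < a].
  near=> a; split.
  - by near: a; apply: cvg_at_left_filter h; exact: cvg_id.
  - by near: a; exact: nbhs_left_lt.
  - by near: a; apply: nbhs_left_gt; rewrite oppr_lt0.
move=> /filter_ex[a [clq a0 ad]].
set q := p + a *: rot90 u in clq.
have sq : s q = 0 by rewrite /s /q /dot /= !/(_ *: _) /=; ring.
have tq : t q = a.
  transitivity (a * dot u u); last by rewrite uu mulr1.
  by rewrite /t /q /dot /= !/(_ *: _) /=; ring.
have cs : continuous s by exact: continuous_dot.
have ct : continuous t by exact: continuous_dot.
have : \forall y \near q, [/\ `|s y| < d, `|t y| < d & t y + `|L| * `|s y| < 0].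
  have cns : continuous (fun y => `|s y|).
    by move=> y; apply: cvg_norm; exact: cs.
  have cnt : continuous (fun y => `|t y|).
    by move=> y; apply: cvg_norm; exact: ct.
  near=> y; split; near: y.
  - by apply: near_lt => //; rewrite sq normr0.
  - by apply: near_lt => //; rewrite tq ltr0_norm// ltrNl.
  - have : \forall y \near q, 1 * t y + `|L| * `|s y| < 0.
      apply: near_lt; first exact: continuous_lin.
      by rewrite sq tq normr0 mulr0 addr0 mul1r.
    by apply: filterS => y; rewrite mul1r.
move=> /clq[y [Oy [sy ty h0]]].
have gy : g (s y) < t y by apply: (gE _ _ sy ty).1; rewrite -co.
have := gL 0 (s y); rewrite sub0r normrN.
have := ler_norm (g 0 - g (s y)).
have : L * `|s y| <= `|L| * `|s y| by rewrite ler_wpM2r// ler_norm.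
lra.
Unshelve. all: by end_near. Qed.

End PlaneTopology.

(** * Edges, vertices and cells of a conforming mesh *)

Section MeshTopology.
Variables (R : realType) (Om : set (plane R)) (T : mesh R).
Hypothesis Om_lip : lipschitz_domain Om.
Hypothesis T_tri : triangulation Om T.

(** A dart is an edge seen from one of its cells, and thereby directed: the cell
    lies on its left. *)
Notation dart := ('I_(ncell T) * 'I_4)%type.
Implicit Types (d e : dart) (k l : 'I_(ncell T)) (p x y : plane R).
Notation region k := (quad_region (cell T k)).
Definition src d : plane R := cell T d.1 d.2.
Definition tgt d : plane R := cell T d.1 (ordS d.2).
Definition dedge d : set (plane R) := quad_edge (cell T d.1) d.2.
Definition dpoint d (t : R) : plane R := src d + t *: (tgt d - src d).

Let convT k : convex_quad (cell T k). Proof. by case: T_tri. Qed.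
Let src_neq_tgt d : src d != tgt d. Proof. exact: vertex_neqS. Qed.

Lemma open_domain : open Om. Proof. by case: Om_lip. Qed.

Lemma closure_cells p : closure Om p <-> exists k, region k p.
Proof.
case: T_tri => _ -> _; split=> [[k _ h]|[k h]]; by exists k.
Qed.

Lemma interior_closure_domain p : interior (closure Om) p -> Om p.
Proof.
move=> iKp; apply: interior_subset; apply: contrapT => nOp.
apply: (@boundary_not_interior_closure _ Om p) => //.
by split=> //; exact: (@interior_subset _ (closure Om)).
Qed.

Lemma near_side_gt0 (a : 'I_4 -> plane R) i x : 0 < side a i x ->
  \forall y \near x, 0 < side a i y.
Proof. by apply: (@near_gt _ (side a i)); exact: continuous_cross. Qed.

Lemma near_region k x : (forall i, 0 < side (cell T k) i x) ->
  \forall y \near x, region k y.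
Proof.
move=> h; have : \forall y \near x, forall i, 0 < side (cell T k) i y.
  by apply: near_all => i; exact: near_side_gt0.
by apply: filterS => y yk; apply/(quad_regionP (convT k)) => i; exact: ltW.
Qed.

(** Finitely many closed cells: near a point only the cells through it matter. *)
Lemma near_cells x : \forall y \near x, forall k, region k y -> region k x.
Proof.
apply: near_all => k; have [kx|nkx] := pselect (region k x); first by apply: filterE.
have [i xi] : exists i, side (cell T k) i x < 0.
  apply: contrapT => h; apply: nkx; apply/(quad_regionP (convT k)) => i.
  by rewrite leNgt; apply/negP => hi; apply: h; exists i.
have : \forall y \near x, side (cell T k) i y < 0.
  by apply: (@near_lt _ (side (cell T k) i)) => //; exact: continuous_cross.
apply: filterS => y yi /(quad_regionP (convT k)) /(_ i).
by rewrite leNgt yi.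
Qed.

Lemma closed_cells (P : 'I_(ncell T) -> Prop) :
  closed [set y | exists2 k, P k & region k y].
Proof.
move=> x /(_ _ (near_cells x))[y [[k Pk ky] yx]].
by exists k => //; exact: yx.
Qed.

Lemma dpoint_in d (t : R) : 0 <= t <= 1 -> dedge d (dpoint d t).
Proof. by move=> t01; apply/segmentP; exists t. Qed.

Lemma src_in d : dedge d (src d).
Proof. by apply/segmentP; exists 0; rewrite ?lexx ?ler01// scale0r addr0. Qed.

Lemma tgt_in d : dedge d (tgt d).
Proof. by apply/segmentP; exists 1; rewrite ?lexx ?ler01// scale1r subrKC. Qed.

Lemma dedge_region d x : dedge d x -> region d.1 x.
Proof. exact: edge_region. Qed.

Lemma dedge_closure d x : dedge d x -> closure Om x.
Proof. by move=> /dedge_region h; apply/closure_cells; exists d.1. Qed.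

Lemma dedge_ends d e : dedge d = dedge e ->
  (src d = src e /\ tgt d = tgt e) \/ (src d = tgt e /\ tgt d = src e).
Proof. by apply: segment_eq; exact: src_neq_tgt. Qed.

Lemma cell_inter k l : k != l ->
  let I := region k `&` region l in
  [\/ I = set0, exists i j, cell T k i = cell T l j /\ I = [set cell T k i] |
      exists i j, quad_edge (cell T k) i = quad_edge (cell T l) j /\
                  I = quad_edge (cell T k) i].
Proof. by case: T_tri => _ _; apply. Qed.

Lemma side_rot90 d (t s : R) :
  side (cell T d.1) d.2 (dpoint d t + s *: rot90 (tgt d - src d)) =
  s * dot (tgt d - src d) (tgt d - src d).
Proof.
rewrite /side /dpoint -/(src d) -/(tgt d) -cross_rot90.
by rewrite /cross /= !/(_ *: _) /= !/(_ *: _) /=; ring.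
Qed.

Lemma dir_dot_gt0 d : 0 < dot (tgt d - src d) (tgt d - src d).
Proof. by apply: dot_gt0; rewrite subr_eq0 eq_sym src_neq_tgt. Qed.

Lemma half01 : 0 < (2^-1 : R) < 1. Proof. by apply/andP; split; lra. Qed.

(** Two cells that traverse an edge in the same direction lie on the same side of
    it and overlap near its midpoint, which conformity excludes. *)
Lemma dart_inj d e : src d = src e -> tgt d = tgt e -> d = e.
Proof.
case: d e => [k i] [l j] se te.
have [kl|kl] := eqVneq k l.
  move: se te; rewrite /src /tgt /= kl => /vertex_inj -> //.
exfalso.
pose m := dpoint (k, i) 2^-1; pose n := rot90 (tgt (k, i) - src (k, i)).
have nr d : src d = src (k, i) -> tgt d = tgt (k, i) ->
    \forall s \near (0 : R)^'+, region d.1 (m + s *: n).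
  move=> sd td.
  have mE : m = dpoint d 2^-1 by rewrite /m /dpoint sd td.
  have nE : n = rot90 (tgt d - src d) by rewrite sd td.
  have : \forall y \near m, forall j', j' != d.2 -> 0 < side (cell T d.1) j' y.
    apply: near_all => j'; have [->|jd] := eqVneq j' d.2; first by apply: filterE.
    have : 0 < side (cell T d.1) j' m.
      by rewrite mE; apply: relint_side => //; exact: half01.
    by move=> /near_side_gt0; apply: filterS.
  move=> /(near_line_right n) mn.
  near=> s; apply/(quad_regionP (convT d.1)) => j'.
  have [->|jd] := eqVneq j' d.2.
    rewrite mE nE side_rot90; apply: mulr_ge0; last exact: ltW (dir_dot_gt0 d).
    by apply: ltW; near: s; exact: nbhs_right_gt.
  by apply: ltW; move: j' jd; near: s.
have h1 := nr (k, i) erefl erefl; have h2 := nr (l, j) (esym se) (esym te).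
have : \forall s \near (0 : R)^'+, [/\ region k (m + s *: n), region l (m + s *: n) & 0 < s].
  near=> s; split; near: s; [exact: h1|exact: h2|exact: nbhs_right_gt].
move=> /filter_ex[s [yk yl s0]].
have sk := dedge_region (src_in (k, i)).
have tk := dedge_region (tgt_in (k, i)).
have sl : region l (src (k, i)) by rewrite se; exact: (dedge_region (src_in (l, j))).
have tl : region l (tgt (k, i)) by rewrite te; exact: (dedge_region (tgt_in (l, j))).
case: (cell_inter kl) => [I0|[i' [j' [_ I1]]]|[i' [j' [_ I2]]]].
- have : (region k `&` region l) (src (k, i)) by [].
  by rewrite I0.
- have : (region k `&` region l) (src (k, i)) by [].
  rewrite I1 => hs; have : (region k `&` region l) (tgt (k, i)) by [].
  rewrite I1 => ht; have := src_neq_tgt (k, i).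
  by rewrite hs ht eqxx.
- have hin x : region k x -> region l x -> side (cell T k) i' x = 0.
    move=> xk xl; apply: (edge_side (a := cell T k)).
    by rewrite -I2; split.
  have mi : side (cell T k) i' m = 0.
    rewrite /m /dpoint side_segment (hin _ sk sl) (hin _ tk tl); ring.
  have ii : i' = i.
    apply/eqP; apply: contraT => ii.
    have := relint_side (convT k) half01 ii.
    by rewrite -/(src (k,i)) -/(tgt (k,i)) -/(dpoint (k,i) 2^-1) -/m mi ltxx.
  have := hin _ yk yl; rewrite ii.
  have := side_rot90 (k, i) 2^-1 s; rewrite /= -/m -/n => -> /eqP.
  by rewrite mulf_eq0 !gt_eqF// dir_dot_gt0.
Unshelve. all: by end_near. Qed.

Lemma twin_reversed d e : dedge d = dedge e -> d != e ->
  src d = tgt e /\ tgt d = src e.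
Proof.
move=> /dedge_ends[[sde tde]|//]; first by rewrite (dart_inj sde tde) eqxx.
Qed.

(** Conformity: a cell that reaches the relative interior of an edge shares the
    whole edge. *)
Lemma relint_cells d (t : R) k : 0 < t < 1 -> region k (dpoint d t) ->
  exists i, dedge (k, i) = dedge d.
Proof.
move=> t01 kp; have [kd|kd] := eqVneq k d.1.
  by exists d.2; rewrite kd; case: d {kp kd}.
have dp : region d.1 (dpoint d t).
  by apply/dedge_region/dpoint_in; case/andP: t01 => /ltW-> /ltW->.
have hI : (region d.1 `&` region k) (dpoint d t) by [].
have dk : d.1 != k by rewrite eq_sym.
case: (cell_inter dk) => [I0|[i [j [_ I1]]]|[i [j [E I2]]]].
- by move: hI; rewrite I0.
- move: hI; rewrite I1 /= => hI.
  by have := relint_not_vertex (convT d.1) d.2 i t01; rewrite -/(src d) -/(tgt d) -/(dpoint d t) hI eqxx.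
- exists j; move: hI; rewrite I2 => /edge_side h.
  have id2 : i = d.2.
    apply/eqP; apply: contraT => id2; have := relint_side (convT d.1) t01 id2.
    by rewrite -/(src d) -/(tgt d) -/(dpoint d t) h ltxx.
  by rewrite /dedge /= -E id2.
Qed.

(** There are no hanging vertices: a cell with a vertex inside the edge would share
    the whole edge and have that vertex inside an edge of its own. *)
Lemma vertex_on_edge d e : dedge d (src e) -> src e = src d \/ src e = tgt d.
Proof.
move=> /segmentP[t /andP[t0 t1] E].
have [t00|tn0] := eqVneq t 0; first by left; rewrite E t00 scale0r addr0.
have [t11|tn1] := eqVneq t 1; first by right; rewrite E t11 scale1r subrKC.
have t01 : 0 < t < 1 by rewrite !lt_neqAle t0 t1 tn1 eq_sym tn0.
have Ed : src e = dpoint d t by [].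
have := @relint_cells d t e.1 t01; rewrite -Ed => /(_ (dedge_region (src_in e)))[i di].
have n1 : src e != src d by rewrite Ed; exact: relint_not_vertex.
have n2 : src e != tgt d by rewrite Ed; exact: relint_not_vertex.
have ein : dedge (e.1, i) (src e) by rewrite di; apply/segmentP; exists t => //; rewrite t0 t1.
have [m1 m2] : src e != src (e.1, i) /\ src e != tgt (e.1, i).
  by case: (dedge_ends di) => -[-> ->].
have [ei|ei] := eqVneq e.2 i.
  by move: m1; rewrite /src /= ei eqxx.
have := edge_relint (convT e.1) ein m1 m2 ei.
by rewrite side_vertex ltxx.
Qed.

(** Near a relatively interior point of an edge with a single cell, that cell is
    all there is of the closed domain, so that points just across the edge lie
    outside. *)
Lemma free_edge_boundary d : (forall e, dedge e = dedge d -> e = d) ->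
  dedge d `<=` boundary Om.
Proof.
move=> free.
have relB (t : R) : 0 < t < 1 -> boundary Om (dpoint d t).
  move=> t01; have dp : dedge d (dpoint d t).
    by apply/dpoint_in; case/andP: t01 => /ltW-> /ltW->.
  split; first exact: dedge_closure dp.
  move=> iO; have iK : nbhs (dpoint d t) (closure Om).
    by apply: filterS iO; exact: subset_closure.
  have : \forall y \near dpoint d t, region d.1 y.
    near=> y; have : closure Om y by near: y.
    move=> /closure_cells[k ky]; have kp : region k (dpoint d t).
      by move: k ky; near: y; exact: near_cells.
    by have [i /free di] := relint_cells t01 kp; rewrite -di.
  move=> /(near_line_right (- rot90 (tgt d - src d))) h.
  have : \forall s \near (0:R)^'+,
     region d.1 (dpoint d t + s *: - rot90 (tgt d - src d)) /\ 0 < s.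
    near=> s; split; near: s; [exact: h|exact: nbhs_right_gt].
  move=> /filter_ex[s [/(quad_regionP (convT d.1)) /(_ d.2) + s0]].
  rewrite scalerN -scaleNr side_rot90 mulNr oppr_ge0 leNgt.
  by rewrite mulr_gt0// dir_dot_gt0.
have cB : closed (boundary Om).
  rewrite /boundary setDE; apply: closedI; first exact: closed_closure.
  by apply: open_closedC; exact: open_interior.
have endp (v w : plane R) : (forall t : R, 0 < t < 1 -> boundary Om (v + t *: (w - v))) ->
   boundary Om v.
  move=> vw; apply: cB => B /(near_line_right (w - v)) h.
  have : \forall s \near (0:R)^'+, [/\ B (v + s *: (w - v)), 0 < s & s < 1].
    near=> s; split; near: s; [exact: h|exact: nbhs_right_gt|exact: nbhs_right_lt].
  move=> /filter_ex[s [Bs s0 s1]]; exists (v + s *: (w - v)); split => //.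
  by apply: vw; rewrite s0 s1.
move=> x /segmentP[t /andP[t0 t1] ->].
have [t00|tn0] := eqVneq t 0.
  by rewrite t00 scale0r addr0; apply: endp relB.
have [t11|tn1] := eqVneq t 1.
  rewrite t11 scale1r subrKC; apply: (endp _ (src d)) => s /andP[s0 s1].
  have -> : tgt d + s *: (src d - tgt d) = dpoint d (1 - s).
    by rewrite /dpoint scalerBl scale1r addrA subrKC -scalerN opprB.
  by apply: relB; rewrite subr_gt0 s1 ltrBlDr ltrDl s0.
by apply: relB; rewrite !lt_neqAle t0 t1 tn1 eq_sym tn0.
Unshelve. all: by end_near. Qed.

(** The two cells of a shared edge lie on opposite sides and together fill a
    neighbourhood of each of its relatively interior points. *)
Lemma twin_interior d e (t : R) : dedge d = dedge e -> d != e -> 0 < t < 1 ->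
  interior (closure Om) (dpoint d t).
Proof.
move=> de ned t01; have [sde tde] := twin_reversed de ned.
have pE : dpoint d t = dpoint e (1 - t).
  by rewrite /dpoint sde tde scalerBl scale1r addrA subrKC -scalerN opprB.
have t01' : 0 < 1 - t < 1 by case/andP: t01 => t0 t1; rewrite subr_gt0 t1 ltrBlDr ltrDl t0.
have nr f (s : R) : 0 < s < 1 -> \forall y \near dpoint f s, forall j, j != f.2 ->
    0 < side (cell T f.1) j y.
  move=> s01; apply: near_all => j.
  have [->|jf] := eqVneq j f.2; first by apply: filterE => y; rewrite ?eqxx.
  have := relint_side (convT f.1) s01 jf => /near_side_gt0.
  by apply: filterS.
have opp y : side (cell T e.1) e.2 y = - side (cell T d.1) d.2 y.
  rewrite /side -!/(src _) -!/(tgt _) sde tde /cross /=; ring.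
rewrite /interior; near=> y; apply/closure_cells.
have hd : forall j, j != d.2 -> 0 < side (cell T d.1) j y by near: y; exact: nr.
have he : forall j, j != e.2 -> 0 < side (cell T e.1) j y by near: y; rewrite pE; exact: nr.
have [h|h] := lerP 0 (side (cell T d.1) d.2 y).
  exists d.1; apply/(quad_regionP (convT _)) => j.
  by have [->//|/hd/ltW] := eqVneq j d.2.
exists e.1; apply/(quad_regionP (convT _)) => j.
have [->|/he/ltW//] := eqVneq j e.2.
by rewrite opp oppr_ge0 ltW.
Unshelve. all: by end_near. Qed.

(** Without a second cell, [free_edge_boundary] applies; with one, the midpoint of
    the edge is interior to the closure of the domain. *)
Lemma twinP d : ~ dedge d `<=` boundary Om <-> exists2 e, dedge e = dedge d & e != d.
Proof.
split=> [nB|[e ed ned] B].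
  apply: contrapT => h; apply: nB; apply: free_edge_boundary => e ed.
  by apply/eqP; apply: contraT => ned; exfalso; apply: h; exists e.
have Bm : boundary Om (dpoint d 2^-1).
  by apply: B; apply: dpoint_in; case/andP: half01 => /ltW-> /ltW->.
apply: boundary_not_interior_closure Bm _ => //.
by apply: (@twin_interior d e) half01; rewrite // eq_sym.
Qed.

Lemma boundary_edge_free d e : dedge d `<=` boundary Om -> dedge e = dedge d -> e = d.
Proof.
move=> B ed; apply/eqP; apply: contraT => ned.
by exfalso; apply: (twinP d).2 B; exists e.
Qed.

Lemma interior_point p : closure Om p -> (forall d, p <> src d) ->
  (forall d, dedge d `<=` boundary Om -> ~ dedge d p) -> interior (closure Om) p.
Proof.
move=> /closure_cells[k kp] nv nb.
have [i i0|gt0] := pickP (fun i => side (cell T k) i p == 0); last first.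
  have : \forall y \near p, region k y.
    apply: near_region => i; rewrite lt_neqAle eq_sym gt0 /=.
    exact: ((quad_regionP (convT k) p).1 kp i).
  by apply: filterS => y ky; apply/closure_cells; exists k.
have : dedge (k, i) p by apply: region_side0 => //; exact/eqP.
move=> /[dup] pd /segmentP[t /andP[t0 t1] E].
have [e ek ne] : exists2 e, dedge e = dedge (k, i) & e != (k, i).
  by apply/twinP => B; exact: (nb _ B pd).
have tn0 : t != 0.
  by apply/eqP => t00; apply: (nv (k, i)); rewrite E t00 scale0r addr0.
have tn1 : t != 1.
  by apply/eqP => t11; apply: (nv (k, ordS i)); rewrite E t11 scale1r subrKC.
rewrite E; apply: (@twin_interior (k, i) e) => //; first by rewrite eq_sym.
by rewrite !lt_neqAle t0 t1 tn1 eq_sym tn0.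
Qed.

Lemma near_no_vertex x : \forall y \near x, y <> x -> forall d, y <> src d.
Proof.
have : \forall y \near x, forall d, src d <> x -> y <> src d.
  apply: near_all => d; have [->|/eqP dx] := eqVneq (src d) x; first by apply: filterE.
  have : nbhs x (~` [set src d]).
    apply: open_nbhs_nbhs; split; last by move=> /esym.
    by apply: closed_openC; apply: accessible_closed_set1; apply: hausdorff_accessible; exact: norm_hausdorff.
  by apply: filterS => y yd _ /yd.
by apply: filterS => y h yx d yd; apply: (h d) => //; rewrite -yd.
Qed.

Lemma quad_inner_interior k : interior (closure Om) (quad_inner (cell T k)).
Proof.
have := near_region (quad_inner_side (convT k)).
by apply: filterS => y ky; apply/closure_cells; exists k.
Qed.

(** Otherwise the closed domain would be a neighbourhood of each of its points in
    a punctured disc about the vertex, so it would contain the disc, and the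
    vertex would be interior to the closure. *)
Lemma boundary_vertex_edge d : boundary Om (src d) ->
  exists e, dedge e `<=` boundary Om /\ (src d = src e \/ src d = tgt e).
Proof.
move=> Bx; apply: contrapT => noe.
have nb e : dedge e `<=` boundary Om -> ~ dedge e (src d).
  by move=> eB /vertex_on_edge h; apply: noe; exists e.
have := boundary_not_interior_closure Om_lip Bx; apply.
have cE e : closed (dedge e).
  rewrite (_ : dedge e = [set y | exists2 k, k = e.1 & region k y] `&`
     side (cell T e.1) e.2 @^-1` [set 0]).
    apply: closedI; first exact: closed_cells.
    apply: preimage_closed; first by move=> y _; exact: continuous_cross.
    by apply: accessible_closed_set1; apply: hausdorff_accessible; exact: norm_hausdorff.
  apply/seteqP; split=> y.
    by move=> ye; split; [exists e.1 => //; exact: dedge_region|exact: edge_side ye].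
  by move=> [[k -> ky] /= y0]; exact: region_side0.
have nearE : \forall y \near src d, forall e, dedge e `<=` boundary Om -> ~ dedge e y.
  apply: near_all => e; have [eB|neB] := pselect (dedge e `<=` boundary Om); last by apply: filterE.
  have : nbhs (src d) (~` dedge e).
    by apply: open_nbhs_nbhs; split; [exact: closed_openC|exact: nb].
  by apply: filterS.
(* In the second alternative of the dichotomy there would be no inner points of
   a cell near its own vertex. *)
have := @punctured_ball _ (closure Om) (closure (~` closure Om)) (src d)
  [set y | (y <> src d -> forall e, y <> src e) /\
           (forall e, dedge e `<=` boundary Om -> ~ dedge e y)].
case.
- exact: closed_closure.
- exact: closed_closure.
- by near=> y; split; near: y; [exact: near_no_vertex|exact: nearE].
- move=> y _ _; have [ky|nky] := pselect (closure Om y); first by left.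
  by right; exact: subset_closure.
- move=> y [/= nv nE] /eqP /nv {}nv Ky /(_ _ (interior_point Ky nv nE)).
  by case=> z [].
- by [].
- move=> /(near_line_right (quad_inner (cell T d.1) - src d)) h.
  have : \forall t \near (0:R)^'+, [/\ closure (~` closure Om)
      (src d + t *: (quad_inner (cell T d.1) - src d)), 0 < t & t < 1].
    near=> t; split; near: t; [exact: h|exact: nbhs_right_gt|exact: nbhs_right_lt].
  move=> /filter_ex[t [+ t0 t1]].
  have : \forall y \near src d + t *: (quad_inner (cell T d.1) - src d), region d.1 y.
    apply: near_region => i; rewrite side_segment.
    have s0 : 0 <= (1 - t) * side (cell T d.1) i (src d).
      by apply: mulr_ge0; [rewrite subr_ge0 ltW|exact: side_vertex_ge0].
    by apply: (ltr_wpDl s0); rewrite mulr_gt0// quad_inner_side.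
  move=> nr /(_ _ nr)[y [nKy dy]]; case: nKy.
  by apply/closure_cells; exists d.1.
Unshelve. all: by end_near. Qed.

(** Two groups of cells without a common interior edge only meet, inside the
    domain, at vertices.  A vertex does not disconnect a disc about it, so the
    interiors of the two groups would split the domain into disjoint open sets. *)
Lemma edge_connected (A : Type) (c : 'I_(ncell T) -> A) :
  (forall d e, dedge d = dedge e -> c d.1 = c e.1) -> forall k l, c k = c l.
Proof.
move=> cE k0 l0; apply: contrapT => ckl.
pose P k := c k = c k0.
pose S := [set y | exists2 k, P k & region k y].
pose S' := [set y | exists2 k, ~ P k & region k y].
have cS : closed S by exact: closed_cells.
have cS' : closed S' by exact: closed_cells.
have cover y : Om y -> S y \/ S' y.
  move=> /subset_closure/closure_cells[k ky].
  by have [Pk|nPk] := pselect (P k); [left|right]; exists k.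
have meet y : Om y -> S y -> S' y -> exists d, y = src d.
  move=> Oy [k Pk ky] [l Pl ly]; have kl : k != l.
    by apply: contra_notN Pl => /eqP <-.
  have hI : (region k `&` region l) y by [].
  case: (cell_inter kl) => [I0|[i [j [_ I1]]]|[i [j [E I2]]]].
  - by move: hI; rewrite I0.
  - by exists (k, i); move: hI; rewrite I1.
  - by exfalso; apply: Pl; rewrite /P -Pk; apply/esym/(cE (k, i) (l, j)).
have dich p : Om p -> nbhs p S \/ nbhs p S'.
  move=> Op; have nO : nbhs p Om by apply: open_nbhs_nbhs; split=> //; exact: open_domain.
  apply: (@punctured_ball _ _ _ p [set y | Om y /\ (y <> p -> forall e, y <> src e)]) => //.
  - by near=> y; split; near: y; [exact: nO|exact: near_no_vertex].
  - by move=> y [/cover].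
  - by move=> y [Oy nv] /eqP/nv h Sy S'y; have [d /h] := meet y Oy Sy S'y.
have excl p : Om p -> nbhs p S -> nbhs p S' -> False.
  move=> Op pS pS'.
  have nO : nbhs p Om by apply: open_nbhs_nbhs; split=> //; exact: open_domain.
  have : \forall y \near p, [/\ Om y, S y, S' y & y <> p -> forall e, y <> src e].
    near=> y; split; near: y; [exact: nO|exact: pS|exact: pS'|exact: near_no_vertex].
  move=> /(near_line_right (1, 0)) h.
  have : \forall t \near (0:R)^'+, 0 < t /\
    [/\ Om (p + t *: (1, 0)), S (p + t *: (1, 0)), S' (p + t *: (1, 0)) &
     p + t *: (1, 0) <> p -> forall e, p + t *: (1, 0) <> src e].
    by near=> t; split; near: t; [exact: nbhs_right_gt|exact: h].
  move=> /filter_ex[t [t0 [Oy Sy S'y nv]]].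
  have [d] := meet _ Oy Sy S'y; apply: nv.
  move=> /(congr1 fst) /= /eqP; rewrite -subr_eq0 addrAC subrr add0r.
  by rewrite /GRing.scale /= mulr1 gt_eqF.
have inner k : Om (quad_inner (cell T k)).
  by apply: interior_closure_domain; exact: quad_inner_interior.
have innerS (Q : 'I_(ncell T) -> Prop) k : Q k ->
    nbhs (quad_inner (cell T k)) [set y | exists2 k, Q k & region k y].
  move=> Qk; have := near_region (quad_inner_side (convT k)).
  by apply: filterS => y ky; exists k.
have conO : connected Om by case: Om_lip.
have E : Om `&` interior S = Om.
  apply: conO.
  - exists (quad_inner (cell T k0)); split; first exact: inner.
    exact: innerS.
  - by exists (interior S) => //; exact: open_interior.
  - exists (~` interior S'); first by apply: open_closedC; exact: open_interior.
    apply/seteqP; split=> y [Oy h]; split=> //.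
      by move=> h'; exact: (excl y).
    by have [//|] := dich y Oy.
have Pl : ~ P l0 by move=> h; apply: ckl; rewrite h.
apply: (excl (quad_inner (cell T l0))) => //; last exact: innerS.
by have := inner l0; rewrite -{1}E => -[].
Unshelve. all: by end_near. Qed.

End MeshTopology.

(** * Exactness from a rank count *)

Section RankCount.
Variable F : fieldType.

(** Rank count: [A] has rank m and [B] has rank at least p - 1, so the row kernel
    of [B], of dimension at most n - (p - 1) <= m, is exhausted by the row space
    of [A] that it contains. *)
Lemma mx_exact (m n p : nat) (A : 'M[F]_(m, n)) (B : 'M[F]_(n, p)) :
  A *m B = 0 -> (forall u : 'rV_m, u *m A = 0 -> u = 0) ->
  (forall c : 'cV_p, B *m c = 0 -> forall l l', c l 0 = c l' 0) ->
  (n + 1 <= m + p)%N -> forall u : 'rV_n, u *m B = 0 -> (u <= A)%MS.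
Proof.
move=> AB injA kerB le_n u uB.
have rA : \rank A = m.
  apply/eqP; rewrite -/(row_free A) -kermx_eq0; apply/eqP/row_matrixP => i.
  by rewrite row0; apply: injA; rewrite -row_mul mulmx_ker row0.
have rB : (p <= \rank B + 1)%N.
  have := mxrank_ker B^T; rewrite mxrank_tr => rk.
  have : (\rank (kermx B^T) <= 1)%N.
    have sub : (kermx B^T <= (const_mx 1 : 'rV[F]_p))%MS.
      apply/row_subP => i; set r := row i _.
      have rB0 : r *m B^T = 0 by rewrite -row_mul mulmx_ker row0.
      have {}rB0 : B *m r^T = 0 by rewrite -[B]trmxK -trmx_mul rB0 trmx0.
      have rc := kerB _ rB0.
      have [j _|p0] := pickP 'I_p.
        have -> : r = r 0 j *: const_mx 1.
          by apply/rowP => l; rewrite !mxE mulr1; have := rc l j; rewrite !mxE.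
        exact: scalemx_sub (submx_refl _).
      have -> : r = 0 by apply/rowP => l; have := p0 l.
      exact: sub0mx.
    exact: leq_trans (mxrankS sub) (rank_leq_row _).
  by rewrite rk; have := rank_leq_col B; lia.
have rk := mxrank_ker B.
have le_rk : (\rank (kermx B) <= \rank A)%N by rewrite rk rA; lia.
have sub : (A <= kermx B)%MS by apply/sub_kermxP.
apply: (@submx_trans _ _ _ _ _ _ (kermx B)); first exact/sub_kermxP.
by rewrite -(geq_leqif (mxrank_leqif_sup sub)).
Qed.

(** The form in which the rank count applies to functions on vertices, edges and
    cells: [A] and [B] are the two coboundary maps. *)
Lemma cochain_exact (I J L : finType) (A : I -> J -> F) (B : J -> L -> F) :
  (forall f l, \sum_j (\sum_i f i * A i j) * B j l = 0) ->
  (forall f, (forall j, \sum_i f i * A i j = 0) -> forall i, f i = 0) ->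
  (forall c, (forall j, \sum_l B j l * c l = 0) -> forall l l', c l = c l') ->
  (#|J| + 1 <= #|I| + #|L|)%N ->
  forall u, (forall l, \sum_j u j * B j l = 0) ->
  exists f, forall j, u j = \sum_i f i * A i j.
Proof.
move=> AB injA kerB le_J u uB.
pose MA := \matrix_(i < #|I|, j < #|J|) A (enum_val i) (enum_val j).
pose MB := \matrix_(j < #|J|, l < #|L|) B (enum_val j) (enum_val l).
have sumE (K : finType) (g : K -> F) : \sum_k g k = \sum_(k < #|K|) g (enum_val k).
  by rewrite (reindex _ (onW_bij _ (enum_val_bij K))).
have mulA (v : 'rV_#|I|) j : (v *m MA) 0 j =
    \sum_i v 0 (enum_rank i) * A i (enum_val j).
  by rewrite mxE [RHS]sumE; apply: eq_bigr => k _; rewrite !mxE enum_valK.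
have mulB (v : 'rV_#|J|) l : (v *m MB) 0 l =
    \sum_j v 0 (enum_rank j) * B j (enum_val l).
  by rewrite mxE [RHS]sumE; apply: eq_bigr => k _; rewrite !mxE enum_valK.
have /submxP[v uE] : ((\row_j u (enum_val j)) <= MA)%MS.
  apply: (@mx_exact _ _ _ MA MB).
  - apply/row_matrixP => i; rewrite row0 row_mul; apply/rowP => l.
    rewrite mulB mxE -[RHS](AB (fun i' => (i' == enum_val i)%:R) (enum_val l)).
    apply: eq_bigr => j _; congr (_ * _); rewrite !mxE enum_rankK.
    rewrite (bigD1 (enum_val i))//= eqxx mul1r big1 ?addr0// => i' /negbTE->.
    by rewrite mul0r.
  - move=> v v0; apply/rowP => i; rewrite mxE -[i]enum_valK.
    apply: (injA (fun i => v 0 (enum_rank i))) => j.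
    by have := mulA v (enum_rank j); rewrite enum_rankK v0 mxE => <-.
  - move=> c c0 l l'; rewrite -[l]enum_valK -[l']enum_valK.
    apply: (kerB (fun l => c (enum_rank l) 0)) => j.
    have := congr1 (fun M : 'cV_ _ => M (enum_rank j) 0) c0.
    rewrite [X in X = _]mxE [X in _ = X]mxE => c0'; rewrite -[RHS]c0' [LHS]sumE.
    by apply: eq_bigr => k _; rewrite mxE enum_rankK enum_valK.
  - exact: le_J.
  - apply/rowP => l; rewrite mulB mxE -[RHS](uB (enum_val l)).
    by apply: eq_bigr => j _; rewrite mxE enum_rankK.
exists (fun i => v 0 (enum_rank i)) => j.
have := congr1 (fun M : 'rV_ _ => M 0 (enum_rank j)) uE.
by rewrite mulA mxE enum_rankK.
Qed.

End RankCount.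

(** * Relative cohomology of the mesh *)

Section MeshCohomology.
Variables (R : realType) (Om : set (plane R)) (T : mesh R).
Hypothesis Om_lip : lipschitz_domain Om.
Hypothesis T_tri : triangulation Om T.

Notation dart := ('I_(ncell T) * 'I_4)%type.
Implicit Types (d e : dart) (k l : 'I_(ncell T)) (x y : plane R).

Let convT k : convex_quad (cell T k). Proof. by case: T_tri. Qed.

Lemma mem_mesh_vertices x : reflect (exists d, x = src d) (x \in mesh_vertices T).
Proof.
rewrite /mesh_vertices; apply: (iffP idP) => [/imfset2P[k _ [i _ ->]]|[[k i] ->]]; first by exists (k, i).
by apply: in_imfset2.
Qed.

Lemma mem_mesh_edges (E : set (plane R)) :
  reflect (exists d, E = dedge d) (E \in mesh_edges T).
Proof.
rewrite /mesh_edges; apply: (iffP idP) => [/imfset2P[k _ [i _ ->]]|[[k i] ->]]; first by exists (k, i).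
by apply: in_imfset2.
Qed.

Definition next d : dart := (d.1, ordS d.2).

Lemma next_inj : injective next.
Proof.
move=> [k i] [l j] E; have kl : k = l by have := congr1 fst E.
by rewrite kl (_ : i = j)//; have /(can_inj (@ordSK 4)) := congr1 snd E.
Qed.

(** Each cell at a vertex has one dart leaving it and one entering it.  If all the
    leaving darts had twins, these would be as many entering darts, hence all of
    them, and no boundary edge would meet the vertex. *)
Lemma boundary_out_dart d : boundary Om (src d) ->
  exists2 e : dart, src e = src d & dedge e `<=` boundary Om.
Proof.
move=> Bd; apply: contrapT => h.
have tw (e : dart) : exists e' : dart, src e = src d -> dedge e' = dedge e /\ e' != e.
  have [se|se] := eqVneq (src e) (src d); last by exists e => /eqP; rewrite (negbTE se).
  have : ~ dedge e `<=` boundary Om by move=> eB; apply: h; exists e.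
  by move=> /(twinP Om_lip T_tri)[e' ? ?]; exists e'.
have [t tP] := choice tw.
pose Out := [set e : dart | src e == src d]%SET; pose In := [set e : dart | tgt e == src d]%SET.
have cIn : #|In| = #|Out|.
  have -> : In = (next @^-1: Out)%SET by apply/setP => e; rewrite !inE.
  by rewrite card_preimset //; exact: next_inj.
have tinj : {in Out &, injective t}.
  move=> e e'; rewrite !inE => /eqP se /eqP se' tt.
  have [E ne] := tP e se; have [E' ne'] := tP e' se'.
  have [_ r] := twin_reversed T_tri E ne; have [_ r'] := twin_reversed T_tri E' ne'.
  have [s _] := twin_reversed T_tri E ne; have [s' _] := twin_reversed T_tri E' ne'.
  by apply: (dart_inj T_tri); rewrite ?se ?se'// -s -s' tt.
have : (t @: Out)%SET = In.
  apply/eqP; rewrite eqEcard cIn card_in_imset// leqnn andbT.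
  apply/fintype.subsetP => _ /imsetP[e eO ->]; move: eO; rewrite !inE => /eqP se.
  have [E ne] := tP e se; have [_ ->] := twin_reversed T_tri E ne.
  by rewrite se.
have [e [eB [se|te]]] := boundary_vertex_edge Om_lip T_tri Bd.
  by case: h; exists e.
move=> /setP/(_ e); rewrite !inE te eqxx => /imsetP[e' ]; rewrite inE => /eqP se' ee'.
have [E ne] := tP e' se'; rewrite -ee' in E ne.
by have := boundary_edge_free Om_lip T_tri eB (esym E) => ee; rewrite ee eqxx in ne.
Qed.

(** A rightmost vertex: no point of a cell lies farther to the right. *)
Lemma exists_boundary_vertex : exists d, boundary Om (src d).
Proof.
have [x0 Ox0] : Om !=set0 by case: Om_lip.
have [k0 _] : exists k, quad_region (cell T k) x0.
  by apply/(closure_cells T_tri)/subset_closure.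
pose d0 : dart := (k0, ord0).
pose d := [arg max_(e > d0) (src e).1]%O.
have dP e : (src e).1 <= (src d).1.
  by rewrite /d; case: Order.TotalTheory.arg_maxP => // ? _; apply.
have dK : closure Om (src d) by exact: dedge_closure T_tri _ _ (src_in d).
exists d; split => //.
move=> /(near_line_right (1, 0)) h.
have : \forall t \near (0:R)^'+, 0 < t /\ Om (src d + t *: (1, 0)).
  by near=> t; split; near: t; [exact: nbhs_right_gt|exact: h].
move=> /filter_ex[t [t0 /subset_closure/(closure_cells T_tri)[k [w [w0 w1 E]]]]].
have := congr1 fst E; rewrite /= raddf_sum /= => E1.
have : (src d).1 + t <= (src d).1.
  have -> : (src d).1 + t = (src d).1 + t *: 1 by rewrite /GRing.scale /= mulr1.
  rewrite E1 -[leRHS]mul1r -w1 mulr_suml; apply: ler_sum => i _.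
  by rewrite /GRing.scale /= ler_wpM2l//; exact: (dP (k, i)).
by rewrite gerDl leNgt t0.
Unshelve. all: by end_near. Qed.

Definition bd_vertices : {fset plane R} :=
  [fset x in mesh_vertices T | `[< boundary Om x >]]%fset.
Definition int_vertices : {fset plane R} :=
  [fset x in mesh_vertices T | ~~ `[< boundary Om x >]]%fset.
Definition bd_edges : {fset set (plane R)} :=
  [fset E in mesh_edges T | `[< (E `<=` boundary Om)%classic >]]%fset.
Definition int_edges : {fset set (plane R)} :=
  [fset E in mesh_edges T | ~~ `[< (E `<=` boundary Om)%classic >]]%fset.

Lemma card_fset_split (K : choiceType) (A : {fset K}) (P : pred K) :
  (#|` [fset x in A | P x]%fset| + #|` [fset x in A | ~~ P x]%fset| = #|` A|)%N.
Proof.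
rewrite -(cardfsID [fset x in A | P x]%fset A).
rewrite [X in _ = (size (enum_fset X) + _)%N](_ : _ = [fset x in A | P x]%fset); last first.
  by apply/fsetP => x; rewrite !inE /=; case: (x \in A); case: (P x).
rewrite [X in _ = (_ + size (enum_fset X))%N](_ : _ = [fset x in A | ~~ P x]%fset)//.
by apply/fsetP => x; rewrite !inE /=; case: (x \in A); case: (P x).
Qed.

(** Each boundary vertex emits a boundary dart, and a boundary edge carries only one
    dart. *)
Lemma card_bd_vertices : (#|` bd_vertices| <= #|` bd_edges|)%N.
Proof.
have out x : exists d, x \in bd_vertices -> src d = x /\ dedge d `<=` boundary Om.
  have [xB|xB] := boolP (x \in bd_vertices); last first.
    by have [d0 _] := exists_boundary_vertex; exists d0.
  move: xB; rewrite !inE /= => /andP[/mem_mesh_vertices[d ->] /asboolP Bd].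
  by have [e se eB] := boundary_out_dart Bd; exists e.
have [f fP] := choice out.
have inj : {in bd_vertices &, injective (fun x => dedge (f x))}.
  move=> x y xB yB E; have [sx _] := fP x xB; have [sy B] := fP y yB.
  by rewrite -sx -sy (boundary_edge_free Om_lip T_tri B E).
have /eqP <- := introT (card_in_imfsetP _ _) inj.
apply: fsubset_leq_card; apply/fsubsetP => _ /imfsetP[x /= xB ->].
have [_ B] := fP x xB; rewrite !inE /=; apply/andP; split; last exact/asboolP.
by apply/mem_mesh_edges; exists (f x).
Qed.

(** Euler's formula for the mesh relative to its boundary. *)
Lemma card_int_edges : euler_formula T ->
  (#|` int_edges| + 1 <= #|` int_vertices| + ncell T)%N.
Proof.
have hv : (#|` bd_vertices| + #|` int_vertices| = #|` mesh_vertices T|)%N.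
  exact: card_fset_split.
have he : (#|` bd_edges| + #|` int_edges| = #|` mesh_edges T|)%N.
  exact: card_fset_split.
rewrite /euler_formula -hv -he; move: card_bd_vertices.
move: (#|` _|)%N (#|` _|)%N (#|` _|)%N (#|` _|)%N => b1 b2 b3 b4; lia.
Qed.

Section Cochains.
(** A chosen dart on each interior edge gives it a direction. *)
Variable rep : int_edges -> dart.
Hypothesis repP : forall E : int_edges, dedge (rep E) = val E.
Implicit Types (delta : dart -> R).

(** The 1-cochains of the mesh relative to its boundary. *)
Definition alternating delta :=
  (forall d e, dedge d = dedge e -> d != e -> delta d = - delta e) /\
  (forall d, dedge d `<=` boundary Om -> delta d = 0).

(** The sign is only meaningful for the darts carried by [E]. *)
Definition sgn (E : int_edges) d : R := if d == rep E then 1 else -1.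
Definition incidence_vertex (x : int_vertices) (E : int_edges) : R :=
  (val x == tgt (rep E))%:R - (val x == src (rep E))%:R.
Definition incidence_cell (E : int_edges) k : R :=
  \sum_i (dedge (k, i) == val E)%:R * sgn E (k, i).

Definition extend0 (f : int_vertices -> R) x : R := oapp f 0 (insub x).

Lemma extend0_boundary f x : boundary Om x -> extend0 f x = 0.
Proof.
by move=> Bx; rewrite /extend0 insubF// !inE /=; case: asboolP => //; rewrite andbF.
Qed.

Lemma extend0_sum f y : \sum_x f x * (val x == y)%:R = extend0 f y.
Proof.
rewrite /extend0; case: insubP => [v _ vy|yV] /=.
  rewrite (bigD1 v)//= vy eqxx mulr1 big1 ?addr0// => x xv.
  by rewrite -vy (inj_eq val_inj) (negbTE xv) mulr0.
rewrite big1// => x _; case: eqP => [xy|]; last by rewrite mulr0.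
by move: yV; rewrite -xy (valP x).
Qed.

Lemma coboundaryE f E :
  \sum_x f x * incidence_vertex x E = extend0 f (tgt (rep E)) - extend0 f (src (rep E)).
Proof.
rewrite /incidence_vertex -!extend0_sum -sumrB; apply: eq_bigr => x _.
by rewrite mulrBr.
Qed.

Lemma int_edgeP d : (dedge d \in int_edges) = ~~ `[< dedge d `<=` boundary Om >].
Proof.
by rewrite !inE /=; case: (mem_mesh_edges (dedge d)) => // h; case: h; exists d.
Qed.

(** The coboundary of a relative 1-cochain, evaluated on a cell, is its
    circulation around the cell. *)
Lemma alternating_sum delta k : alternating delta ->
  \sum_E delta (rep E) * incidence_cell E k = \sum_i delta (k, i).
Proof.
move=> [alt bd]; under eq_bigr do rewrite mulr_sumr.
rewrite exchange_big /=; apply: eq_bigr => i _.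
have [iE|nE] := boolP (dedge (k, i) \in int_edges); last first.
  rewrite bd; last by move: nE; rewrite int_edgeP negbK => /asboolP.
  rewrite big1// => E _; case: eqP => [e|]; last by rewrite mul0r mulr0.
  by move: nE; rewrite e (valP E).
pose E : int_edges := [` iE]%fset.
have rE : dedge (rep E) = dedge (k, i) by rewrite repP.
rewrite (bigD1 E)//= eqxx mul1r big1 => [|F FE]; last first.
  case: eqP => [e|]; last by rewrite mul0r mulr0.
  by move: FE; rewrite -(inj_eq val_inj) /= -e eqxx.
rewrite addr0 /sgn; case: eqP => [<-|/eqP ne]; first by rewrite mulr1.
by rewrite mulrN1 (alt _ _ rE) ?opprK// eq_sym.
Qed.

Definition grad (psi : plane R -> R) d : R := psi (tgt d) - psi (src d).

Lemma boundary_ends d : dedge d `<=` boundary Om ->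
  boundary Om (src d) /\ boundary Om (tgt d).
Proof. by move=> dB; split; apply: dB; [exact: src_in|exact: tgt_in]. Qed.

Lemma alternating_grad psi : (forall x, boundary Om x -> psi x = 0) ->
  alternating (grad psi).
Proof.
move=> psi0; split=> [d e de ned|d /boundary_ends[s t]]; last first.
  by rewrite /grad !psi0// subrr.
by have [s t] := twin_reversed T_tri de ned; rewrite /grad s t opprB.
Qed.

Lemma alternating_eq delta gamma : alternating delta -> alternating gamma ->
  (forall E, delta (rep E) = gamma (rep E)) -> delta =1 gamma.
Proof.
move=> [da db] [ga gb] h d.
have [iE|nE] := boolP (dedge d \in int_edges); last first.
  by move: nE; rewrite int_edgeP negbK => /asboolP B; rewrite db ?gb.
pose E : int_edges := [` iE]%fset.
have rE : dedge d = dedge (rep E) by rewrite repP.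
have [->//|ne] := eqVneq d (rep E).
by rewrite (da _ _ rE ne) (ga _ _ rE ne) h.
Qed.

(** A function with zero increments is constant on each cell, hence on the whole
    mesh since neighbouring cells share vertices; the constant is the value at
    some boundary vertex. *)
Lemma grad0_const psi : (forall x, boundary Om x -> psi x = 0) ->
  (forall d, grad psi d = 0) -> forall d, psi (src d) = 0.
Proof.
move=> psi0 g0 d.
have st e : psi (tgt e) = psi (src e) by apply/eqP; rewrite -subr_eq0; apply/eqP; exact: g0.
pose c k := psi (cell T k ord0).
have cE e : psi (src e) = c e.1.
  case: e => k i; have h j : psi (cell T k (ordS j)) = psi (cell T k j) := st (k, j).
  move: i; apply: (@ord4_ind _ ord0); by rewrite /src /c /= ?h.
have cc : forall k l, c k = c l.
  apply: (edge_connected Om_lip T_tri) => e e' ee.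
  have [[se _]|[se _]] := dedge_ends T_tri ee; rewrite -(cE e) -(cE e') se //.
have [d0 Bd0] := exists_boundary_vertex.
by rewrite cE (cc _ d0.1) -cE psi0.
Qed.

(** An interior edge is traversed once in each direction by its two cells, so the
    equation attached to it says that [c] takes the same value on both. *)
Lemma incidence_cell_kernel (c : 'I_(ncell T) -> R) :
  (forall E, \sum_k incidence_cell E k * c k = 0) -> forall k l, c k = c l.
Proof.
move=> c0; apply: (edge_connected Om_lip T_tri) => d e de.
have [->//|ne] := eqVneq d e.
have iE : dedge d \in int_edges.
  rewrite int_edgeP; apply/asboolP; apply/(twinP Om_lip T_tri).
  by exists e; rewrite // eq_sym.
pose E : int_edges := [` iE]%fset.
have only f : dedge f = dedge d -> f = d \/ f = e.
  move=> fd; have [->|fd'] := eqVneq f d; first by left.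
  right; have [s t] := twin_reversed T_tri fd fd'.
  have [s' t'] := twin_reversed T_tri de ne.
  by apply: (dart_inj T_tri); rewrite ?s ?t.
have := c0 E; under eq_bigr do rewrite mulr_suml.
rewrite pair_big /= => S0.
have : \sum_f (dedge f == dedge d)%:R * sgn E f * c f.1 = 0.
  by rewrite -[RHS]S0; apply: eq_bigr => -[k i] _.
rewrite (bigD1 d)//= eqxx (bigD1 e) 1?eq_sym//= -de eqxx big1 => [|f /andP[fd fe]]; last first.
  case: eqP => [/only[h|h]|]; last by rewrite !mul0r.
    by rewrite h eqxx in fd.
  by rewrite h eqxx in fe.
rewrite addr0 !mul1r /sgn.
have [rd|re] := only (rep E) (repP E).
  by rewrite -rd eqxx eq_sym rd (negbTE ne) mul1r mulN1r => /eqP; rewrite subr_eq0 => /eqP.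
rewrite re (negbTE ne) eqxx mul1r mulN1r addrC => /eqP.
by rewrite subr_eq0 eq_sym => /eqP.
Qed.

End Cochains.

(** The first cohomology of the mesh relative to its boundary vanishes: relative
    0-cochains inject, the dual of the second coboundary map has only constants
    in its kernel, and the Euler count leaves no room for more. *)
Lemma cochain_potential (delta : dart -> R) : euler_formula T ->
  alternating delta -> (forall k, \sum_i delta (k, i) = 0) ->
  exists2 psi, (forall x, boundary Om x -> psi x = 0) &
    forall d, delta d = grad psi d.
Proof.
move=> eul altd closed_d.
have repE : forall E : int_edges, exists d, dedge d = val E.
  move=> E; have : val E \in mesh_edges T by move: (valP E); rewrite !inE /= => /andP[].
  by move=> /mem_mesh_edges[d ->]; exists d.
have [rep repP] := choice repE.
have altg f := @alternating_grad (extend0 f) (@extend0_boundary f).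
have [f fE] : exists f, forall E, delta (rep E) = \sum_x f x * incidence_vertex rep x E.
  apply: (@cochain_exact _ _ _ _ (incidence_vertex rep) (incidence_cell rep)).
  - move=> f k; rewrite -[RHS](_ : \sum_i grad (extend0 f) (k, i) = 0).
      rewrite -(alternating_sum repP k (altg f)); apply: eq_bigr => E _.
      by rewrite coboundaryE.
    rewrite (sum_ord4 _ ord0) /grad /src /tgt /= ordS4; ring.
  - move=> f f0.
    have g0 d : grad (extend0 f) d = 0.
      apply: (@alternating_eq rep repP _ (fun=> 0) (altg f)); first by split=> // *; rewrite oppr0.
      by move=> E; rewrite /grad -coboundaryE f0.
    move=> x; have : val x \in mesh_vertices T by move: (valP x); rewrite !inE /= => /andP[].
    move=> /mem_mesh_vertices[d xd].
    by have := grad0_const (@extend0_boundary f) g0 d; rewrite -xd /extend0 valK.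
  - exact: incidence_cell_kernel.
  - by rewrite card_ord -!cardfE; exact: card_int_edges.
  - by move=> k; rewrite (alternating_sum repP).
exists (extend0 f); first exact: extend0_boundary.
apply: (alternating_eq repP) => // E; by rewrite fE coboundaryE.
Qed.

End MeshCohomology.

(** * The image of the discrete curl *)

Section EdgeAverages.
Variable R : realType.
Implicit Types (f g : plane R -> R) (u v n : plane R).

Lemma line_average_increment u v f g1 g2 : u != v ->
  has_grad f g1 g2 -> continuous g1 -> continuous g2 ->
  f v - f u = (v - u).1 * line_average u v g1 + (v - u).2 * line_average u v g2.
Proof.
move=> uv fg c1 c2; rewrite -(line_average_derive uv fg c1 c2).
by rewrite (has_grad_deriveE _ fg) line_average_lin.
Qed.

Lemma line_average_normal u v n f g1 g2 : u != v ->
  has_grad f g1 g2 -> continuous g1 -> continuous g2 ->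
  line_average u v ('D_n f) = n.1 * line_average u v g1 + n.2 * line_average u v g2.
Proof. by move=> uv fg c1 c2; rewrite (has_grad_deriveE _ fg) line_average_lin. Qed.

(** The edge direction and a unit normal form an orthogonal basis, so that the mean
    gradient over an edge is known from the end values and the mean normal
    derivative. *)
Lemma line_average_grad u v n f g1 g2 : u != v -> enorm n = 1 -> dot n (v - u) = 0 ->
  has_grad f g1 g2 -> continuous g1 -> continuous g2 ->
  line_average u v g1 = (v - u).1 * (f v - f u) / dot (v - u) (v - u)
    + n.1 * line_average u v ('D_n f) /\
  line_average u v g2 = (v - u).2 * (f v - f u) / dot (v - u) (v - u)
    + n.2 * line_average u v ('D_n f).
Proof.
move=> uv n1 nt fg c1 c2.
rewrite (line_average_increment uv fg c1 c2) (line_average_normal n uv fg c1 c2).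
have D0 : dot (v - u) (v - u) != 0 by rewrite gt_eqF// dot_gt0// subr_eq0 eq_sym.
have nn : dot n n = 1 by rewrite -enorm_sqr n1 expr1n.
move: (line_average u v g1) (line_average u v g2) => a b.
move: D0 nt nn; rewrite /dot; case: (v - u) n {fg c1 c2 n1} => [t1 t2] [p q] /=.
move=> D0 nt nn.
have e1 : (t1 * t1 + t2 * t2) * (p * p) = t2 * t2.
  transitivity (t2 * t2 * (p * p + q * q) + (p * t1 + q * t2) * (p * t1 - q * t2)); first by ring.
  by rewrite nn nt mul0r addr0 mulr1.
have e2 : (t1 * t1 + t2 * t2) * (p * q) = - (t1 * t2).
  transitivity (- (t1 * t2) * (p * p + q * q) + (p * t1 + q * t2) * (p * t2 + q * t1)); first by ring.
  by rewrite nn nt mul0r addr0 mulr1.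
have e3 : (t1 * t1 + t2 * t2) * (q * q) = t1 * t1.
  transitivity (t1 * t1 * (p * p + q * q) + (p * t1 + q * t2) * (q * t2 - p * t1)); first by ring.
  by rewrite nn nt mul0r addr0 mulr1.
split; apply: (mulfI D0); rewrite mulrDr [X in _ = X + _]mulrC divfK//.
  transitivity (t1 * (t1 * a + t2 * b) + (((t1 * t1 + t2 * t2) * (p * p)) * a +
     ((t1 * t1 + t2 * t2) * (p * q)) * b)); last by ring.
  by rewrite e1 e2; ring.
transitivity (t2 * (t1 * a + t2 * b) + (((t1 * t1 + t2 * t2) * (p * q)) * a +
     ((t1 * t1 + t2 * t2) * (q * q)) * b)); last by ring.
by rewrite e2 e3; ring.
Qed.

Lemma P_quad_opp (a : 'I_4 -> plane R) f : P_quad a f -> P_quad a (fun x => - f x).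
Proof.
move=> /P_quadP[p0 [p1 [p2 [b [c ->]]]]]; apply/P_quadP.
by exists (- p0), (- p1), (- p2), (- b), (- c); apply/funext => x; ring.
Qed.

Lemma PM_quad_addc (a : 'I_4 -> plane R) f c : PM_quad a f -> PM_quad a (fun x => f x + c).
Proof.
move=> /PM_quadP[c0 [c1 [c2 [c3 [c4 [c5 [b [e ->]]]]]]]]; apply/PM_quadP.
by exists (c0 + c), c1, c2, c3, c4, c5, b, e; apply/funext => x; ring.
Qed.

Lemma curl_addc f g1 g2 c : has_grad f g1 g2 -> curl (fun x => f x + c) = curl f.
Proof.
move=> fg; have fcg := has_gradD fg (has_grad_cst c).
apply/funext => x; rewrite /curl (has_grad_dxE fg) (has_grad_dyE fg).
by rewrite (has_grad_dxE fcg) (has_grad_dyE fcg) !addr0.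
Qed.

Lemma line_averageN u v f : u != v -> continuous f ->
  line_average u v (fun x => - f x) = - line_average u v f.
Proof.
move=> uv cf; rewrite -mulN1r -line_averageZ//; congr line_average.
by apply/funext => x; rewrite mulN1r.
Qed.

End EdgeAverages.

Section CurlImage.
Variables (R : realType) (Om : set (plane R)) (T : mesh R).
Hypothesis Om_lip : lipschitz_domain Om.
Hypothesis T_tri : triangulation Om T.
Variable n : set (plane R) -> plane R.
Hypothesis n_normal : unit_normals T n.

Notation dart := ('I_(ncell T) * 'I_4)%type.
Implicit Types (d e : dart) (k l : 'I_(ncell T)) (i j : 'I_4).

Let convT k : convex_quad (cell T k). Proof. by case: T_tri. Qed.
Let src_neq_tgt d : src d != tgt d. Proof. exact: vertex_neqS. Qed.

Lemma src_mesh d : src d \in mesh_vertices T.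
Proof. by apply/mem_mesh_vertices; exists d. Qed.

Lemma dedge_mesh d : dedge d \in mesh_edges T.
Proof. by apply/mem_mesh_edges; exists d. Qed.

Lemma curl_average (f : plane R -> R) k i : PM_quad (cell T k) f ->
  let d := (k, i) in let t := tgt d - src d in let m := n (dedge d) in
  edge_average k i (fun x => (curl f x).1) =
    t.2 * (f (tgt d) - f (src d)) / dot t t + m.2 * edge_average k i ('D_m f) /\
  edge_average k i (fun x => (curl f x).2) =
    - (t.1 * (f (tgt d) - f (src d)) / dot t t + m.1 * edge_average k i ('D_m f)).
Proof.
move=> fM d t m; have [/P_quad_continuous cx /P_quad_continuous cy fg _] := curl_PM fM.
have [m1 mt] := n_normal k i.
have [e1 e2] := line_average_grad (src_neq_tgt d) m1 mt fg cx cy.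
by split; [exact: e2|rewrite /edge_average line_averageN ?(src_neq_tgt d)// e1].
Qed.

(** By [curl_average], the averages of the curl over an edge are determined by the
    degrees of freedom of the Morley space on that edge, which agree from both
    sides and vanish on the boundary. *)
Lemma curl_Mh0 w : Mh0 Om T n w ->
  Vh0_vec Om T (curl_h w) /\ div_h (curl_h w) = fun=> fun=> 0.
Proof.
move=> [wM wv we wbv wbe].
have vE d e x : src d = x -> src e = x -> w d.1 x = w e.1 x.
  move=> dx ex; apply: (wv x _ d.1 e.1 d.2 e.2) => //; rewrite -dx; exact: src_mesh.
have tgtE d : tgt d = src (next d) by [].
(* Reversing the edge changes the sign of both factors. *)
have inc d e : dedge d = dedge e -> forall s : R * R -> R, (forall x, s (- x) = - s x) ->
    s (tgt d - src d) * (w d.1 (tgt d) - w d.1 (src d)) / dot (tgt d - src d) (tgt d - src d) =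
    s (tgt e - src e) * (w e.1 (tgt e) - w e.1 (src e)) / dot (tgt e - src e) (tgt e - src e).
  move=> de s sN; have [[sd td]|[sd td]] := dedge_ends T_tri de.
    rewrite sd td; have -> := vE d e _ sd erefl.
    by have -> : w d.1 (tgt e) = w e.1 (tgt e) by exact: (vE (next d) (next e) _ td erefl).
  rewrite sd td; have -> : w d.1 (tgt e) = w e.1 (tgt e) by exact: (vE d (next e) _ sd erefl).
  have -> : w d.1 (src e) = w e.1 (src e) by exact: (vE (next d) e _ td erefl).
  rewrite -opprB sN; have -> : dot (- (tgt e - src e)) (- (tgt e - src e)) =
    dot (tgt e - src e) (tgt e - src e) by rewrite /dot /=; ring.
  by congr (_ / _); rewrite -[w e.1 (src e) - _]opprB mulrNN.
have bv d : dedge d `<=` boundary Om -> w d.1 (tgt d) = 0 /\ w d.1 (src d) = 0.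
  move=> /boundary_ends[bs bt]; split.
    by apply: (wbv _ _ d.1 (ordS d.2)) => //; split => //; exact: (src_mesh (next d)).
  by apply: (wbv _ _ d.1 d.2) => //; split => //; exact: src_mesh.
have cP k := curl_PM (wM k).
split; last by apply/funext => k; have [] := cP k.
split; split.
- by move=> k; have [_ + _ _] := cP k.
- move=> E iE k l i j kE lE.
  rewrite [LHS](curl_average i (wM k)).1 [RHS](curl_average j (wM l)).1.
  have de : dedge (k, i) = dedge (l, j) by rewrite /dedge /= kE lE.
  have iE' := inc _ _ de snd (fun x => erefl).
  have aE : edge_average k i ('D_(n (dedge (k, i))) (w k)) =
      edge_average l j ('D_(n (dedge (k, i))) (w l)).
    by rewrite /dedge /= kE; exact: (we E iE k l i j kE lE).
  by rewrite -de aE; congr (_ + _).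
- move=> E bE k i kE; rewrite (curl_average i (wM k)).1.
  have [EM EB] := bE; rewrite -kE in EB; have [-> ->] := bv (k, i) EB.
  rewrite /dedge /= subrr mulr0 mul0r add0r.
  by rewrite kE (wbe E bE k i kE) mulr0.
- by move=> k; have [+ _ _ _] := cP k; exact: P_quad_opp.
- move=> E iE k l i j kE lE.
  rewrite [LHS](curl_average i (wM k)).2 [RHS](curl_average j (wM l)).2.
  have de : dedge (k, i) = dedge (l, j) by rewrite /dedge /= kE lE.
  have iE' := inc _ _ de fst (fun x => erefl).
  have aE : edge_average k i ('D_(n (dedge (k, i))) (w k)) =
      edge_average l j ('D_(n (dedge (k, i))) (w l)).
    by rewrite /dedge /= kE; exact: (we E iE k l i j kE lE).
  by rewrite -de aE; congr (- (_ + _)).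
- move=> E bE k i kE; rewrite (curl_average i (wM k)).2.
  have [EM EB] := bE; rewrite -kE in EB; have [-> ->] := bv (k, i) EB.
  rewrite /dedge /= subrr mulr0 mul0r add0r.
  by rewrite kE (wbe E bE k i kE) mulr0 oppr0.
Qed.

(** The increments of the local potentials along the edges are the normal fluxes of
    [w], so they form a closed cochain relative to the boundary; a potential [psi]
    of it prescribes the constants by which the local potentials must be shifted
    to agree at the vertices and to vanish on the boundary. *)
Lemma div_free_potential w : euler_formula T ->
  Vh0_vec Om T w -> div_h w = (fun=> fun=> 0) ->
  exists2 phi, Mh0 Om T n phi & curl_h phi = w.
Proof.
move=> eul [[P1 c1 b1] [P2 c2 b2]] dv.
have wE k : w k = fun x => ((w k x).1, (w k x).2).
  by apply/funext => x; case: (w k x).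
have pot k : exists phi, PM_quad (cell T k) phi /\ curl phi = w k.
  have [|phi ? ?] := potential (convT k) (P1 k) (P2 k); first by rewrite -wE; have := congr1 (@^~ k) dv.
  by exists phi; rewrite wE.
have [phi phiP] := choice pot.
have phiM k := (phiP k).1; have phiC k := (phiP k).2.
have dyE k : dy (phi k) = fun x => (w k x).1 by rewrite -phiC.
have dxE k : dx (phi k) = fun x => -1 * (w k x).2.
  by rewrite -phiC; apply/funext => x; rewrite /= mulN1r opprK.
have cw1 k := P_quad_continuous (P1 k); have cw2 k := P_quad_continuous (P2 k).
pose A1 d := edge_average d.1 d.2 (fun x => (w d.1 x).1).
pose A2 d := edge_average d.1 d.2 (fun x => (w d.1 x).2).
have gradP k : [/\ has_grad (phi k) (dx (phi k)) (dy (phi k)),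
    continuous (dx (phi k)) & continuous (dy (phi k))].
  by have [/P_quad_continuous ? /P_quad_continuous ? ? _] := curl_PM (phiM k).
have avx d : edge_average d.1 d.2 (dx (phi d.1)) = - A2 d.
  by rewrite dxE /edge_average line_averageZ ?(src_neq_tgt d)// mulN1r.
have avy d : edge_average d.1 d.2 (dy (phi d.1)) = A1 d by rewrite dyE.
(* delta d is the flux of w across the edge. *)
pose delta d := phi d.1 (tgt d) - phi d.1 (src d).
have deltaE d : delta d = (tgt d - src d).2 * A1 d - (tgt d - src d).1 * A2 d.
  have [fg cx cy] := gradP d.1.
  rewrite /delta (line_average_increment (src_neq_tgt d) fg cx cy).
  by rewrite -/(edge_average d.1 d.2 _) avx -/(edge_average d.1 d.2 _) avy; ring.
have int d e : dedge d = dedge e -> d != e -> interior_edge Om T (dedge d).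
  move=> de ne; split; first exact: dedge_mesh.
  by apply/(twinP Om_lip T_tri); exists e; rewrite // eq_sym.
have A1E d e : dedge d = dedge e -> A1 d = A1 e.
  move=> de; have [->//|ne] := eqVneq d e.
  exact: (c1 _ (int _ _ de ne)).
have A2E d e : dedge d = dedge e -> A2 d = A2 e.
  move=> de; have [->//|ne] := eqVneq d e.
  exact: (c2 _ (int _ _ de ne)).
have A1b d : dedge d `<=` boundary Om -> A1 d = 0.
  by move=> dB; apply: (b1 (dedge d)); split=> //; exact: dedge_mesh.
have A2b d : dedge d `<=` boundary Om -> A2 d = 0.
  by move=> dB; apply: (b2 (dedge d)); split=> //; exact: dedge_mesh.
have altd : alternating Om delta.
  split=> [d e de ne|d dB]; last by rewrite deltaE A1b// A2b// !mulr0 subr0.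
  have [sd td] := twin_reversed T_tri de ne.
  by rewrite !deltaE (A1E _ _ de) (A2E _ _ de) sd td /=; ring.
have closed_d k : \sum_i delta (k, i) = 0.
  by rewrite (sum_ord4 _ ord0) /delta /src /tgt /= ordS4; ring.
have [psi psi0 psiE] := cochain_potential Om_lip T_tri eul altd closed_d.
pose c k := psi (cell T k ord0) - phi k (cell T k ord0).
pose w' k x := phi k x + c k.
have w'v d : w' d.1 (src d) = psi (src d).
  case: d => k i; rewrite /w' /c /src /=.
  have st j : phi k (cell T k (ordS j)) - psi (cell T k (ordS j)) =
      phi k (cell T k j) - psi (cell T k j).
    have := psiE (k, j); rewrite /delta /grad /src /tgt /= => /eqP; rewrite subr_eq => /eqP ->.
    ring.
  have h : phi k (cell T k i) - psi (cell T k i) =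
      phi k (cell T k ord0) - psi (cell T k ord0).
    by move: i; apply: (@ord4_ind _ ord0); rewrite // !st.
  by rewrite -opprB -h; ring.
have w'g k : has_grad (w' k) (dx (phi k)) (dy (phi k)).
  have [fg _ _] := gradP k.
  by apply: has_grad_eq (has_gradD fg (has_grad_cst (c k))) _ _ => x; rewrite addr0.
have w'n d m : edge_average d.1 d.2 ('D_m (w' d.1)) = - m.1 * A2 d + m.2 * A1 d.
  have [fg cx cy] := gradP d.1.
  rewrite /edge_average (line_average_normal m (src_neq_tgt d) (w'g d.1) cx cy).
  by rewrite -/(edge_average d.1 d.2 _) avx -/(edge_average d.1 d.2 _) avy mulrN mulNr.
exists w'; last first.
  apply/funext => k; rewrite /curl_h -phiC; have [fg _ _] := gradP k.
  exact: curl_addc fg.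
split.
- by move=> k; exact: PM_quad_addc.
- by move=> x _ k l i j kx lx; rewrite -{1}kx -lx (w'v (k, i)) (w'v (l, j)) /src /= kx lx.
- move=> E _ k l i j kE lE; rewrite (w'n (k, i)) (w'n (l, j)).
  by rewrite (@A1E (k, i) (l, j)) ?(@A2E (k, i) (l, j))// /dedge /= kE lE.
- by move=> x [_ Bx] k i kx; rewrite -kx (w'v (k, i)) psi0// /src /= kx.
- move=> E [_ EB] k i kE; rewrite (w'n (k, i)) A1b ?A2b ?mulr0 ?addr0//;
  by rewrite /dedge /= kE.
Qed.

End CurlImage.

Theorem lemma10 (R : realType) (Om : set (R * R)%type)
    (H : Type) (T : H -> mesh R)
    (Om_lipschitz : lipschitz_domain Om)
    (Om_simply_connected : simply_connected Om)
    (T_triangulation : forall h, triangulation Om (T h))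
    (T_euler : forall h, euler_formula (T h))
    (T_regular : regular_family T)
    (h : H) (n : set (R * R)%type -> (R * R)%type)
    (n_normal : unit_normals (T h) n) :
  [set curl_h w | w in Mh0 Om (T h) n] =
  [set w | Vh0_vec Om (T h) w /\ div_h w = fun=> fun=> 0].
Proof.
apply/seteqP; split=> [_ [w wM <-]|w [wV dw]].
  exact (curl_Mh0 (T_triangulation h) n_normal wM).
have [phi phiM <-] := div_free_potential Om_lipschitz (T_triangulation h)
  n (T_euler h) wV dw.
by exists phi.
Qed.
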